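(* Let $N\ge1$ be an integer and $k\in(0,1)$, and set $$P_1:=\frac{2\arctan k+(k+4)(N-1)}{1-k},\qquad P_2:=\frac{(N-1)k}{2}.$$ Then there exists a unique $P\in[P_2,P_1]$ such that the problem $$\frac{\varphi''(z)}{1+[\varphi'(z)]^2}=p[\varphi(z)-z\varphi'(z)]-\frac{N-1}{z}\varphi'(z),\quad 0<z<1,\qquad \varphi'(0)=0,\ \varphi(1)=1,\ \varphi'(1)=k,$$ with $p=P$ has a solution. Moreover, the unique solution, denoted by $\varphi=\Phi(z;k)\in C^\infty([0,1])$, satisfies $$0<\Phi(z;k)<1,\quad 0<\Phi'(z;k)<k\ \text{ in }(0,1),\qquad \Phi''(z;k)>0\ \text{ in }[0,1].$$
   Context: Solutions are understood in the classical sense. (If $\varphi$ solves the problem with parameter $p$, then $u(r,t)=\sqrt{2pt}\,\varphi(r/\sqrt{2pt})$ is a self-similar solution of $u_t=\frac{u_{rr}}{1+u_r^2}+\frac{(N-1)u_r}{r}$ whose graph meets the line $y=r$ at $r=\sqrt{2pt}$ with slope $k$.) *)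

(* Defs.v *)
From Stdlib Require Import Reals.
Open Scope R_scope.

Definition closed01 (z : R) : Prop := 0 <= z <= 1.
Definition open01 (z : R) : Prop := 0 < z < 1.

(* Differentiation on a domain is Stdlib's [D_in], the limit of the difference
   quotient taken within the domain: one-sided at the end points of [0,1], and
   insensitive to the values of the functions off the domain. *)

(* [d n] is the n-th derivative of [f] on [D], for every n. *)
Definition iterated_derivatives (D : R -> Prop) (f : R -> R)
    (d : nat -> R -> R) : Prop :=
  (forall z, D z -> d 0%nat z = f z) /\
  (forall n z, D z -> D_in (d n) (d (S n)) D z).

(* C^infty([0,1]) is [smooth closed01]; the continuity of each derivative
   follows from its differentiability. *)
Definition smooth (D : R -> Prop) (f : R -> R) : Prop :=
  exists d, iterated_derivatives D f d.

(* Classical solution: phi in C^1([0,1]) and C^2((0,1)), with [phi1] and [phi2]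
   its first and second derivatives. *)
Definition is_solution (N : nat) (k p : R) (phi : R -> R) : Prop :=
  exists phi1 phi2 : R -> R,
    (forall z, closed01 z -> D_in phi phi1 closed01 z) /\
    (forall z, closed01 z -> continue_in phi1 closed01 z) /\
    (forall z, open01 z -> D_in phi1 phi2 open01 z) /\
    (forall z, open01 z -> continue_in phi2 open01 z) /\
    (forall z, open01 z ->
       phi2 z / (1 + (phi1 z) ^ 2)
       = p * (phi z - z * phi1 z) - (INR N - 1) / z * phi1 z) /\
    phi1 0 = 0 /\ phi 1 = 1 /\ phi1 1 = k.

Definition P1 (N : nat) (k : R) : R :=
  (2 * atan k + (k + 4) * (INR N - 1)) / (1 - k).

Definition P2 (N : nat) (k : R) : R := (INR N - 1) * k / 2.

(* Main.v *)
Require Import Defs.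
From Stdlib Require Import Reals Lra Lia IndefiniteDescription.
From Coquelicot Require Import Coquelicot.
Open Scope R_scope.

(** Write [n = N - 1], [w = phi'], [theta = atan w] and [q = phi - z w], the
    height at which the tangent line meets the axis. The equation is
    [theta' = p q - n w / z], and [q' = - z w'].

    Signs. Both a single solution and the difference of two solutions obey one
    linear system (record [comparison]) in which the slope and the angle have the
    same sign. At a point where the angle vanishes the system gives
    [theta' = p phi], so the height has no positive interior maximum, and a
    trajectory that leaves the axis at positive height keeps rising. Conversely a
    positive final slope forces [phi 0 > 0] ([comparison_start_positive]). The
    curvature [G = p q - n w / z] satisfies [(z G)' >= - K (z G)] where it is
    nonnegative, so it stays positive up to [z = 1] ([curvature_positive]). Hence
    [0 < w < k] in (0, 1), and at [z = 1] one gets [p (1 - k) > n k], which is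
    stronger than [p >= P2].

    Uniqueness. If [p1 < p2], the data at 1 make the second solution higher just
    before 1, and the difference then has a positive interior maximum or a positive
    starting value; both are impossible ([extension_p_le]). For equal [p] the same
    comparison shows that the difference vanishes ([extension_same_p]).

    Existence is by shooting from the singular end. The tangent is replaced by a
    globally Lipschitz function that agrees with it for angles up to [PI/4]; a slope
    that increases from 0 to [k < 1] is unaffected. The unknown [u = theta / z] is
    a fixed point of [u = int_0^1 t^n F(u)(t z) dt], which is a contraction on the
    whole line in the norm weighted by [exp (L z ^ 2)] ([picard_contracts]). The
    fixed point depends on [p] and on the starting height [a] in a Lipschitz way.
    For each [p] some [a] gives [phi 1 = 1], and it is Lipschitz in [p] because
    trajectories with the same [p] spread apart ([profile_spread]). Then [p] is
    adjusted so that [w 1 = k]: the final angle is at most [atan k] when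
    [p = atan k] and at least [atan k] when [p = P1] ([shooting]).

    Smoothness. The solution extends evenly through 0 and a little beyond 1. On
    this interval [g = w / z] is the average of a polynomial in [z], phi, [w]
    and [g], and a bootstrap gains one derivative at a time ([bootstrap]). *)

(** * Elementary analysis on the line *)

Ltac solve_continuous :=
  repeat match goal with
  | H : ?G |- ?G => exact H
  | |- continuous (fun x => ?c) _ => apply continuous_const
  | |- continuous (fun x => x) _ => apply continuous_id
  | |- continuous (fun x => @?f x - @?g x) _ => apply (continuous_minus (V := R_NormedModule) f g)
  | |- continuous (fun x => @?f x + @?g x) _ => apply (continuous_plus (V := R_NormedModule) f g)
  | |- continuous (fun x => @?f x * @?g x) _ => apply (continuous_mult (K := R_AbsRing) f g)
  | |- continuous (fun x => ?f x) ?z => change (continuous f z)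
  end.

Lemma continuous_pt (f : R -> R) (x : R) : continuous f x -> continuity_pt f x.
Proof. intros H. apply continuity_pt_filterlim. exact H. Qed.

Ltac rewrite_derive H :=
  match type of H with
  | is_derive ?f ?x ?l =>
      replace (Derive (fun y => f y) x) with l by (symmetry; exact (is_derive_unique f x l H))
  end.

Lemma derive_continuous (f : R -> R) (x l : R) : is_derive f x l -> continuous f x.
Proof. intros H. apply (ex_derive_continuous (V := R_NormedModule)). now exists l. Qed.

Lemma mean_value (f df : R -> R) (a b : R) :
  a < b ->
  (forall x, a < x < b -> is_derive f x (df x)) ->
  (forall x, a <= x <= b -> continuous f x) ->
  exists c, a < c < b /\ f b - f a = df c * (b - a).
Proof.
  intros Hab Hd Hc.
  pose (pr1 := fun c Hx => exist (fun l => derivable_pt_lim f c l) (df c)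
                 (proj1 (is_derive_Reals f c (df c)) (Hd c Hx))).
  pose (pr2 := fun c (_ : a < c < b) => derivable_pt_id c).
  destruct (MVT f id a b pr1 pr2 Hab) as [c [P H]].
  - intros c H. apply continuous_pt. auto.
  - intros c _. apply derivable_continuous_pt, derivable_pt_id.
  - exists c. split; [exact P|].
    unfold pr1, pr2 in H. unfold derive_pt at 1 in H. simpl in H.
    rewrite derive_pt_id in H. unfold id in H. lra.
Qed.

Lemma derive_nonneg_le (f df : R -> R) (a b : R) :
  a <= b ->
  (forall x, a < x < b -> is_derive f x (df x) /\ 0 <= df x) ->
  (forall x, a <= x <= b -> continuous f x) ->
  f a <= f b.
Proof.
  intros [Hab|<-] Hd Hc; [|lra].
  destruct (mean_value f df a b Hab) as [c [Hi E]]; auto.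
  - intros x Hx. now apply Hd.
  - destruct (Hd c Hi) as [_ H]. nra.
Qed.

Lemma derive_pos_lt (f df : R -> R) (a b : R) :
  a < b ->
  (forall x, a < x < b -> is_derive f x (df x) /\ 0 < df x) ->
  (forall x, a <= x <= b -> continuous f x) ->
  f a < f b.
Proof.
  intros Hab Hd Hc.
  destruct (mean_value f df a b Hab) as [c [Hi E]]; auto.
  - intros x Hx. now apply Hd.
  - destruct (Hd c Hi) as [_ H]. nra.
Qed.

Lemma derive_pos_local (f : R -> R) (x l : R) :
  is_derive f x l -> 0 < l ->
  exists d, 0 < d /\ (forall y, x < y < x + d -> f x < f y) /\
            (forall y, x - d < y < x -> f y < f x).
Proof.
  intros H Hl. apply is_derive_Reals in H.
  destruct (H l Hl) as [d Hd]. exists d. split; [apply cond_pos|].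
  assert (K : forall y, y <> x -> Rabs (y - x) < d -> 0 < (f y - f x) / (y - x)).
  { intros y Hy Hy'. assert (y - x <> 0) as Hyx by lra. specialize (Hd (y - x) Hyx Hy').
    replace (x + (y - x)) with y in Hd by ring.
    apply Rabs_def2 in Hd. lra. }
  split; intros y Hy.
  - assert (0 < (f y - f x) / (y - x)) as P by (apply K; [lra|rewrite Rabs_right; lra]).
    assert (f y - f x = (f y - f x) / (y - x) * (y - x)) as E by (field; lra). nra.
  - assert (0 < (f y - f x) / (y - x)) as P by (apply K; [lra|rewrite Rabs_left; lra]).
    assert (f y - f x = (f y - f x) / (y - x) * (y - x)) as E by (field; lra). nra.
Qed.

Lemma continuous_pos_local (f : R -> R) (x : R) :
  continuous f x -> 0 < f x -> exists d, 0 < d /\ forall y, Rabs (y - x) < d -> 0 < f y.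
Proof.
  intros H Hp.
  destruct (H (fun y => 0 < y)) as [d Hd].
  - exists (mkposreal _ Hp). intros y Hy.
    unfold ball in Hy; simpl in Hy; unfold AbsRing_ball, abs, minus, plus, opp in Hy; simpl in Hy.
    apply Rabs_def2 in Hy. lra.
  - exists d. split; [apply cond_pos|]. intros y Hy. now apply Hd.
Qed.

Lemma continuous_nonneg_right (f : R -> R) (a b : R) :
  a < b -> continuous f a -> (forall x, a < x < b -> 0 <= f x) -> 0 <= f a.
Proof.
  intros Hab Hc Hp. destruct (Rle_lt_dec 0 (f a)) as [|Hn]; auto.
  destruct (continuous_pos_local (fun x => - f x) a) as [d [Hd K]].
  - now apply (continuous_opp (V := R_NormedModule)).
  - lra.
  - assert (H1 : 0 < Rmin d (b - a)) by (apply Rmin_glb_lt; lra).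
    pose proof (Rmin_l d (b - a)); pose proof (Rmin_r d (b - a)).
    specialize (K (a + Rmin d (b - a) / 2)). rewrite Rabs_right in K by lra.
    specialize (Hp (a + Rmin d (b - a) / 2)). lra.
Qed.

Lemma last_zero (f : R -> R) (a b : R) :
  a <= b -> (forall x, continuous f x) -> f a <= 0 -> 0 < f b ->
  exists c, a <= c < b /\ f c = 0 /\ forall x, c < x <= b -> 0 < f x.
Proof.
  intros Hab Hc Ha Hb.
  destruct (completeness (fun x => a <= x <= b /\ f x <= 0)) as [c [Hu Hl]].
  - exists b. intros x Hx. lra.
  - exists a. lra.
  - assert (Hac : a <= c) by (apply Hu; lra).
    assert (Hcb : c <= b) by (apply Hl; intros x Hx; lra).
    assert (Hr : forall x, c < x <= b -> 0 < f x).
    { intros x Hx. apply Rnot_le_lt. intros Hn. assert (x <= c) by (apply Hu; lra). lra. }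
    assert (Hc0 : f c <= 0).
    { apply Rnot_lt_le. intros Hp.
      destruct (continuous_pos_local f c (Hc c) Hp) as [d [Hd K]].
      assert (c <= c - d); [|lra]. apply Hl. intros x [Hx Hx'].
      apply Rnot_lt_le. intros Hn. assert (x <= c) by (apply Hu; lra).
      assert (0 < f x); [|lra]. apply K. apply Rabs_def1; lra. }
    assert (c <> b) by (intros ->; lra).
    exists c. split; [lra|]. split; [|exact Hr].
    apply Rle_antisym; [exact Hc0|].
    apply (continuous_nonneg_right f c b); [lra|apply Hc|].
    intros x Hx. apply Rlt_le, Hr. lra.
Qed.

Lemma first_zero (f : R -> R) (a b : R) :
  a <= b -> (forall x, continuous f x) -> 0 < f a -> f b <= 0 ->
  exists c, a < c <= b /\ f c = 0 /\ forall x, a <= x < c -> 0 < f x.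
Proof.
  intros Hab Hc Ha Hb.
  destruct (last_zero (fun x => f (- x)) (- b) (- a)) as [c [H1 [H2 H3]]].
  - lra.
  - intros x. apply (continuous_comp Ropp f); [|apply Hc].
    apply (continuous_opp (V := R_NormedModule) (fun y => y)), continuous_id.
  - now rewrite Ropp_involutive.
  - now rewrite Ropp_involutive.
  - exists (- c). split; [lra|]. split; [exact H2|].
    intros x Hx. specialize (H3 (- x)). rewrite Ropp_involutive in H3. apply H3. lra.
Qed.

Lemma attains_min (f : R -> R) (a b : R) :
  a <= b -> (forall x, continuous f x) ->
  exists c, a <= c <= b /\ forall x, a <= x <= b -> f c <= f x.
Proof.
  intros Hab Hc. destruct (continuity_ab_min f a b Hab) as [c [H1 H2]].
  - intros x _. now apply continuous_pt.
  - now exists c.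
Qed.

Lemma attains_max (f : R -> R) (a b : R) :
  a <= b -> (forall x, continuous f x) ->
  exists c, a <= c <= b /\ forall x, a <= x <= b -> f x <= f c.
Proof.
  intros Hab Hc. destruct (continuity_ab_maj f a b Hab) as [c [H1 H2]].
  - intros x _. now apply continuous_pt.
  - now exists c.
Qed.

Definition clamp (a b x : R) : R := Rmax a (Rmin b x).

Lemma clamp_range (a b x : R) : a <= b -> a <= clamp a b x <= b.
Proof.
  intros H. unfold clamp. split; [apply Rmax_l|].
  apply Rmax_lub; [exact H|apply Rmin_l].
Qed.

Lemma clamp_id (a b x : R) : a <= x <= b -> clamp a b x = x.
Proof. intros H. unfold clamp. rewrite Rmin_right, Rmax_right; lra. Qed.

Lemma clamp_lipschitz (a b x y : R) : Rabs (clamp a b x - clamp a b y) <= Rabs (x - y).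
Proof.
  unfold clamp, Rmax, Rmin.
  repeat destruct Rle_dec; unfold Rabs; repeat destruct Rcase_abs; lra.
Qed.

Lemma lipschitz_continuous (f : R -> R) (L x : R) :
  0 <= L -> (forall y, Rabs (f y - f x) <= L * Rabs (y - x)) -> continuous f x.
Proof.
  intros HL H P [e He].
  assert (Hd : 0 < e / (L + 1)) by (apply Rdiv_lt_0_compat; [apply cond_pos|lra]).
  exists (mkposreal _ Hd). intros y Hy. apply He.
  unfold ball in *; simpl in *; unfold AbsRing_ball, abs, minus, plus, opp in *; simpl in *.
  specialize (H y). unfold Rminus in H.
  apply Rle_lt_trans with (1 := H).
  apply Rle_lt_trans with ((L + 1) * Rabs (y + - x)).
  - pose proof (Rabs_pos (y + - x)). nra.
  - apply Rmult_lt_reg_r with (/ (L + 1)); [apply Rinv_0_lt_compat; lra|].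
    replace ((L + 1) * Rabs (y + - x) * / (L + 1)) with (Rabs (y + - x)) by (field; lra).
    exact Hy.
Qed.

Lemma clamp_continuous (a b x : R) : continuous (clamp a b) x.
Proof.
  apply lipschitz_continuous with 1; [lra|]. intros y.
  rewrite Rmult_1_l. apply clamp_lipschitz.
Qed.

Lemma lipschitz_ivt (f : R -> R) (a b L v : R) :
  a <= b -> 0 <= L ->
  (forall x y, a <= x <= b -> a <= y <= b -> Rabs (f x - f y) <= L * Rabs (x - y)) ->
  f a <= v <= f b ->
  exists x, a <= x <= b /\ f x = v.
Proof.
  intros Hab HL Hf Hv.
  destruct (IVT_gen (fun x => f (clamp a b x)) a b v) as [x [Hx E]].
  - intros x. apply continuous_pt, lipschitz_continuous with L; [exact HL|]. intros y.
    apply Rle_trans with (L * Rabs (clamp a b y - clamp a b x)).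
    + apply Hf; now apply clamp_range.
    + apply Rmult_le_compat_l; [exact HL|apply clamp_lipschitz].
  - rewrite !clamp_id by lra. rewrite Rmin_left, Rmax_right; lra.
  - exists (clamp a b x). split; [now apply clamp_range|exact E].
Qed.

Lemma derive_eq (f : R -> R) (x l l' : R) : is_derive f x l -> l = l' -> is_derive f x l'.
Proof. now intros H <-. Qed.

Lemma derive_mult_vanishing (f g : R -> R) l :
  is_derive f 0 l -> f 0 = 0 -> continuous g 0 ->
  is_derive (fun x => f x * g x) 0 (l * g 0).
Proof.
  intros Hf H0 Hg. apply is_derive_Reals in Hf. apply is_derive_Reals.
  assert (Hq : limit1_in (fun h => (f (0 + h) - f 0) / h * g (0 + h)) (fun h => h <> 0) (l * g 0) 0).
  { apply limit_mul.
    - intros e He. destruct (Hf e He) as [d Hd]. exists d. split; [apply cond_pos|].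
      intros h [Hh Hh']. simpl in *. unfold R_dist, Rdist in *. rewrite Rminus_0_r in Hh'.
      now apply Hd.
    - intros e He. apply continuous_pt in Hg. destruct (Hg e He) as [d [Hd K]].
      exists d. split; [exact Hd|]. intros h [Hh Hh']. simpl in *. unfold Rdist in *.
      rewrite Rminus_0_r in Hh'. rewrite Rplus_0_l.
      apply K. split; [split; [exact I|auto]|]. now rewrite Rminus_0_r. }
  intros e He. destruct (Hq e He) as [d [Hd K]]. exists (mkposreal d Hd). intros h Hh Hh'.
  simpl in *. specialize (K h). unfold Rdist in K. rewrite Rminus_0_r in K.
  replace ((f (0 + h) * g (0 + h) - f 0 * g 0) / h) with ((f (0 + h) - f 0) / h * g (0 + h)).
  - apply K. auto.
  - rewrite H0. field. exact Hh.
Qed.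

Lemma Rabs_shift (y z : R) : Rabs y <= Rabs (y + - z) + Rabs z.
Proof. replace y with (y + - z + z) at 1 by ring. apply Rabs_triang. Qed.

Lemma locally_abs_lt r z : Rabs z < r -> locally z (fun y => Rabs y < r).
Proof.
  intros H. assert (Hd : 0 < r - Rabs z) by lra.
  exists (mkposreal _ Hd). intros y Hy.
  unfold ball in Hy; simpl in Hy; unfold AbsRing_ball, abs, minus, plus, opp in Hy; simpl in Hy.
  pose proof (Rabs_shift y z). lra.
Qed.

Lemma continuous_pow n x : continuous (fun t : R => t ^ n) x.
Proof. apply (derive_continuous _ _ (INR n * x ^ pred n)). auto_derive; auto. ring. Qed.

Lemma RInt_reflect (g : R -> R) x :
  (forall y, continuous g y) -> RInt g 0 (- x) = - RInt (fun y => g (- y)) 0 x.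
Proof.
  intros Hg.
  pose proof (RInt_comp_lin (V := R_CompleteNormedModule) g (-1) 0 0 x) as E.
  replace (-1 * 0 + 0) with 0 in E by ring. replace (-1 * x + 0) with (- x) in E by ring.
  rewrite <- E by (apply (ex_RInt_continuous (V := R_CompleteNormedModule)); auto).
  assert (C : forall y, continuous (fun y => g (- y)) y).
  { intros y. apply (continuous_comp Ropp g); [|apply Hg].
    apply (continuous_opp (V := R_NormedModule) (fun y => y)), continuous_id. }
  rewrite <- (RInt_opp (V := R_CompleteNormedModule) (fun y => g (- y)))
    by (apply (ex_RInt_continuous (V := R_CompleteNormedModule)); auto).
  apply RInt_ext. intros y _. unfold scal, opp; simpl; unfold mult; simpl.
  replace (-1 * y + 0) with (- y) by ring. ring.
Qed.

Lemma primitive_derive (g : R -> R) x :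
  (forall y, continuous g y) -> is_derive (RInt g 0) x (g x).
Proof.
  intros Hg. apply (is_derive_RInt (V := R_NormedModule) g _ 0); [|apply Hg].
  apply filter_forall. intros y.
  apply (RInt_correct (V := R_CompleteNormedModule)),
    (ex_RInt_continuous (V := R_CompleteNormedModule)). auto.
Qed.

Lemma constant_of_derive_0 (f : R -> R) r :
  (forall x, Rabs x < r -> is_derive f x 0) -> forall x, Rabs x < r -> f x = f 0.
Proof.
  intros Hf x Hx.
  assert (Hb : forall y, Rmin 0 x <= y <= Rmax 0 x -> Rabs y < r).
  { intros y Hy. unfold Rmin, Rmax in Hy. revert Hx.
    destruct Rle_dec in Hy; unfold Rabs; repeat destruct Rcase_abs; lra. }
  destruct (MVT_gen f 0 x (fun _ => 0)) as [c [_ E]].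
  - intros y Hy. apply Hf, Hb. lra.
  - intros y Hy. apply continuous_pt, derive_continuous with 0, Hf, Hb, Hy.
  - lra.
Qed.

(** * Comparison for the singular linear inequality *)

(** One linear system serves every comparison below. For a single solution,
    [D], [V], [e] are phi, its slope and its angle atan phi', and [r = 0]; for a
    pair they are the differences of these quantities, and a source [r] appears
    when the parameters [p] differ. The nonlinearity survives only in the last
    three fields: the slope is an increasing function of the angle, so [V] and
    [e] have the same sign. *)
Record comparison (n p : R) (r D V e : R -> R) : Prop := {
  cmp_D_cont : forall z, continuous D z;
  cmp_e_cont : forall z, continuous e z;
  cmp_D_derive : forall z, 0 < z < 1 -> is_derive D z (V z);
  cmp_e_derive : forall z, 0 < z < 1 ->
    is_derive e z (p * (D z - z * V z) - n / z * V z + r z);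
  cmp_e0 : e 0 = 0;
  cmp_pos : forall z, 0 < e z -> 0 < V z;
  cmp_zero : forall z, e z = 0 -> V z = 0;
  cmp_neg : forall z, e z < 0 -> V z < 0 }.

Lemma comparison_V_nonneg n p r D V e z : comparison n p r D V e -> 0 <= e z -> 0 <= V z.
Proof.
  intros H [He|He].
  - left. now apply (cmp_pos _ _ _ _ _ _ H).
  - right. symmetry. now apply (cmp_zero _ _ _ _ _ _ H).
Qed.

(** At a nonpositive minimum of [e] the slope term has a favourable sign and
    [e' >= p D > 0], so [e] takes smaller values just to the left. The singular
    coefficient [n / z] multiplies [- V >= 0] there, hence does no harm. *)
Lemma comparison_positive_until n p r D V e b :
  0 < p -> 0 <= n -> (forall z, 0 < z < 1 -> 0 <= r z) ->
  comparison n p r D V e -> 0 < b < 1 -> (forall z, 0 < z <= b -> 0 < D z) -> 0 < e b.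
Proof.
  intros Hp Hn Hr H Hb HD. apply Rnot_le_lt. intros Hneg.
  assert (exists c, 0 < c <= b /\ e c <= 0 /\ forall x, 0 <= x <= b -> e c <= e x)
    as [c [Hc [Hec Hmin]]].
  { destruct (attains_min e 0 b) as [c [Hc Hm]]; [lra|apply H|].
    destruct (Req_dec c 0) as [->|Hc0].
    - (* a minimum at 0 has value 0, so [e b <= 0] makes [b] another minimum *)
      exists b. rewrite (cmp_e0 _ _ _ _ _ _ H) in Hm. repeat split; try lra.
      intros x Hx. specialize (Hm x Hx). lra.
    - exists c. repeat split; try lra; auto. specialize (Hm b). lra. }
  assert (HV : V c <= 0).
  { destruct Hec as [Hec|Hec].
    - left. now apply (cmp_neg _ _ _ _ _ _ H).
    - right. now apply (cmp_zero _ _ _ _ _ _ H). }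
  assert (Hpos : 0 < p * (D c - c * V c) - n / c * V c + r c).
  { specialize (HD c). specialize (Hr c).
    assert (0 <= n / c) by (apply Rdiv_le_0_compat; lra).
    assert (0 < p * D c) by (apply Rmult_lt_0_compat; lra).
    assert (0 <= p * c) by nra. nra. }
  destruct (derive_pos_local e c _ (cmp_e_derive _ _ _ _ _ _ H c ltac:(lra)) Hpos)
    as [d [Hd [_ K]]].
  pose proof (Rmin_l c d); pose proof (Rmin_r c d).
  assert (0 < Rmin c d) by (apply Rmin_glb_lt; lra).
  specialize (K (c - Rmin c d / 2) ltac:(lra)).
  specialize (Hmin (c - Rmin c d / 2) ltac:(lra)). lra.
Qed.

Lemma comparison_increasing_on n p r D V e a b :
  comparison n p r D V e -> 0 <= a <= b -> b <= 1 ->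
  (forall z, a < z < b -> 0 < e z) -> D a <= D b.
Proof.
  intros H Ha Hb He. apply derive_nonneg_le with V; [lra| |intros; apply H].
  intros x Hx. split; [apply H; lra|].
  left. apply (cmp_pos _ _ _ _ _ _ H), He, Hx.
Qed.

(** As long as [D] is positive, [e] is positive and [D] increases; a first
    zero of [D] would therefore lie at a height at least [D 0]. *)
Lemma comparison_positive n p r D V e :
  0 < p -> 0 <= n -> (forall z, 0 < z < 1 -> 0 <= r z) ->
  comparison n p r D V e -> 0 < D 0 -> forall z, 0 < z < 1 -> 0 < e z.
Proof.
  intros Hp Hn Hr H H0 z Hz.
  apply (comparison_positive_until n p r D V e); auto.
  intros y Hy. apply Rnot_le_lt. intros Hneg.
  destruct (first_zero D 0 y) as [c [Hc [E K]]]; [lra|apply H|exact H0|exact Hneg|].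
  assert (D 0 <= D c); [|lra].
  apply (comparison_increasing_on n p r D V e); auto; [lra|lra|].
  intros x Hx. apply (comparison_positive_until n p r D V e); auto; [lra|].
  intros t Ht. apply K. lra.
Qed.

Lemma comparison_increasing n p r D V e :
  0 < p -> 0 <= n -> (forall z, 0 < z < 1 -> 0 <= r z) ->
  comparison n p r D V e -> 0 < D 0 ->
  forall x y, 0 <= x <= y -> y <= 1 -> D x <= D y.
Proof.
  intros Hp Hn Hr H H0 x y Hx Hy.
  apply (comparison_increasing_on n p r D V e); auto.
  intros z Hz. apply (comparison_positive n p r D V e); auto. lra.
Qed.

(** Where [e] vanishes and [D] is positive, [e' >= p D > 0]: the critical
    points of [D] at positive height are strict local minima. *)
Lemma comparison_strict_min n p r D V e m d :
  0 < p -> (forall z, 0 < z < 1 -> 0 <= r z) ->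
  comparison n p r D V e -> 0 < m < 1 -> 0 < d -> e m = 0 -> 0 < D m ->
  (forall z, m - d < z < m -> D z <= D m) -> False.
Proof.
  intros Hp Hr H Hm Hd He HD Hmax.
  assert (Hpos : 0 < p * (D m - m * V m) - n / m * V m + r m).
  { rewrite (cmp_zero _ _ _ _ _ _ H m He). specialize (Hr m Hm).
    assert (0 < p * D m) by (apply Rmult_lt_0_compat; lra). lra. }
  destruct (derive_pos_local e m _ (cmp_e_derive _ _ _ _ _ _ H m Hm) Hpos)
    as [d' [Hd' [_ K]]].
  set (l := Rmin m (Rmin d d')).
  assert (0 < l) by (repeat apply Rmin_glb_lt; lra).
  assert (l <= m) by apply Rmin_l.
  assert (l <= Rmin d d') by apply Rmin_r.
  pose proof (Rmin_l d d'); pose proof (Rmin_r d d').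
  assert (- D (m - l / 2) < - D m).
  { apply (derive_pos_lt (fun z => - D z) (fun z => - V z)); [lra| |].
    - intros x Hx. split.
      + apply (is_derive_opp (V := R_NormedModule)), H. lra.
      + assert (V x < 0); [|lra]. apply (cmp_neg _ _ _ _ _ _ H). rewrite <- He. apply K. lra.
    - intros x _. apply (continuous_opp (V := R_NormedModule)), H. }
  specialize (Hmax (m - l / 2)). lra.
Qed.

Lemma comparison_no_interior_max n p r D V e m d :
  0 < p -> (forall z, 0 < z < 1 -> 0 <= r z) ->
  comparison n p r D V e -> 0 < m < 1 -> 0 < d -> 0 < D m ->
  (forall z, m - d < z < m + d -> D z <= D m) -> False.
Proof.
  intros Hp Hr H Hm Hd HD Hmax.
  pose proof (cmp_D_derive _ _ _ _ _ _ H m Hm) as Hder.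
  destruct (Rtotal_order (e m) 0) as [He|[He|He]].
  - apply (cmp_neg _ _ _ _ _ _ H) in He.
    destruct (derive_pos_local (fun z => - D z) m (- V m)) as [d' [Hd' [_ K]]].
    + now apply (is_derive_opp (V := R_NormedModule)).
    + lra.
    + assert (0 < Rmin d d') by (apply Rmin_glb_lt; lra).
      pose proof (Rmin_l d d'); pose proof (Rmin_r d d').
      specialize (K (m - Rmin d d' / 2)). specialize (Hmax (m - Rmin d d' / 2)). lra.
  - apply (comparison_strict_min n p r D V e m d); auto.
    intros z Hz. apply Hmax. lra.
  - apply (cmp_pos _ _ _ _ _ _ H) in He.
    destruct (derive_pos_local D m (V m)) as [d' [Hd' [K _]]]; auto.
    assert (0 < Rmin d d') by (apply Rmin_glb_lt; lra).
    pose proof (Rmin_l d d'); pose proof (Rmin_r d d').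
    specialize (K (m + Rmin d d' / 2)). specialize (Hmax (m + Rmin d d' / 2)). lra.
Qed.

(** The converse of [comparison_positive] for [r = 0]. Let [a] be the last
    zero of [e] before [b]. If [D a <= 0], then on a short interval after [a] the
    maximum [M] of [e] satisfies [M <= p L c ^ 2 M] with [p L c ^ 2 < 1], which is
    absurd; this replaces a uniqueness theorem for the initial value problem and
    works at the singular point [a = 0] as well. So [D a > 0], and since [D] has no
    local maximum at positive height in (0, a], its maximum on [0, a] is at 0. *)
Lemma comparison_start_positive n p D V e L b :
  0 < p -> 0 <= n -> 0 <= L -> comparison n p (fun _ => 0) D V e ->
  (forall z, 0 <= z <= 1 -> 0 <= e z -> V z <= L * e z) ->
  0 < b < 1 -> 0 < e b -> 0 < D 0.
Proof.
  intros Hp Hn HL H HV Hb Heb.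
  destruct (last_zero e 0 b) as [a [Ha [Ea Ka]]]; [lra|apply H| |exact Heb|].
  { rewrite (cmp_e0 _ _ _ _ _ _ H). lra. }
  assert (HDa : 0 < D a).
  { apply Rnot_le_lt. intros HDa.
    (* the length [c] is chosen so that [p * L * c < 1] and [c <= 1] *)
    set (c := Rmin (b - a) (/ (1 + p * L))).
    assert (HpL : 0 <= p * L) by nra.
    assert (Hc0 : 0 < c).
    { apply Rmin_glb_lt; [lra|]. apply Rinv_0_lt_compat. lra. }
    assert (Hc1 : c <= b - a) by apply Rmin_l.
    assert (Hc2 : (1 + p * L) * c <= 1).
    { replace 1 with ((1 + p * L) * / (1 + p * L)) at 2 by (field; lra).
      apply Rmult_le_compat_l; [lra|apply Rmin_r]. }
    (* [e x1 = e' x2 (x1 - a)] and [D x2 <= V x3 (x2 - a)] with [a < x3 < x2 < x1] *)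
    destruct (attains_max e a (a + c)) as [x1 [Hx1 Hmax]]; [lra|apply H|].
    assert (HM : 0 < e x1).
    { apply Rlt_le_trans with (e (a + c)); [apply Ka; lra|apply Hmax; lra]. }
    assert (Hx1a : a < x1) by (destruct (Req_dec x1 a) as [->|]; lra).
    destruct (mean_value e (fun z => p * (D z - z * V z) - n / z * V z + 0) a x1)
      as [x2 [Hx2 E2]]; [lra| | |].
    { intros x Hx. apply H. lra. }
    { intros x _. apply H. }
    assert (HV2 : 0 < V x2) by (apply (cmp_pos _ _ _ _ _ _ H), Ka; lra).
    destruct (mean_value D V a x2) as [x3 [Hx3 E3]]; [lra| | |].
    { intros x Hx. apply H. lra. }
    { intros x _. apply H. }
    assert (He3 : 0 < e x3) by (apply Ka; lra).
    assert (HV3 : V x3 <= L * e x1).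
    { apply Rle_trans with (L * e x3); [apply HV; lra|].
      apply Rmult_le_compat_l; [lra|apply Hmax; lra]. }
    assert (0 < V x3) by now apply (cmp_pos _ _ _ _ _ _ H).
    assert (HLe : 0 < L * e x1) by lra.
    assert (HD2 : D x2 <= L * e x1 * c).
    { assert (V x3 * (x2 - a) <= L * e x1 * c); [|lra].
      apply Rmult_le_compat; lra. }
    rewrite Ea in E2.
    assert (0 <= n / x2) by (apply Rdiv_le_0_compat; lra).
    assert (HG : p * (D x2 - x2 * V x2) - n / x2 * V x2 + 0 <= p * (L * e x1 * c)).
    { assert (p * D x2 <= p * (L * e x1 * c)) by (apply Rmult_le_compat_l; lra).
      assert (0 <= p * (x2 * V x2)) by (apply Rmult_le_pos; [lra|apply Rmult_le_pos; lra]).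
      assert (0 <= n / x2 * V x2) by (apply Rmult_le_pos; lra). lra. }
    assert (HH : e x1 <= p * (L * e x1 * c) * c).
    { assert (0 <= p * (L * e x1 * c)) by (apply Rmult_le_pos; [lra|apply Rmult_le_pos; lra]).
      destruct (Rle_lt_dec (p * (D x2 - x2 * V x2) - n / x2 * V x2 + 0) 0) as [Hneg|Hpos].
      - assert ((p * (D x2 - x2 * V x2) - n / x2 * V x2 + 0) * (x1 - a) <= 0) by nra. lra.
      - assert ((p * (D x2 - x2 * V x2) - n / x2 * V x2 + 0) * (x1 - a)
                <= p * (L * e x1 * c) * c) by (apply Rmult_le_compat; lra). lra. }
    assert (p * L * c < 1) by lra.
    assert (c <= 1) by nra.
    assert (p * (L * e x1 * c) * c = e x1 * ((p * L * c) * c)) by ring.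
    assert (p * L * c * c < 1). { assert (0 <= p * L * c) by nra. nra. }
    nra. }
  destruct (attains_max D 0 a) as [m [Hm Hmax]]; [lra|apply H|].
  destruct (Req_dec m 0) as [->|Hm0]; [specialize (Hmax a); lra|].
  exfalso.
  assert (HDm : 0 < D m) by (specialize (Hmax a); lra).
  destruct (Req_dec m a) as [->|Hma].
  - apply (comparison_strict_min n p (fun _ => 0) D V e a a); auto; try lra.
    intros; lra. intros z Hz. apply Hmax. lra.
  - assert (0 < Rmin m (a - m)) by (apply Rmin_glb_lt; lra).
    pose proof (Rmin_l m (a - m)); pose proof (Rmin_r m (a - m)).
    apply (comparison_no_interior_max n p (fun _ => 0) D V e m (Rmin m (a - m))); auto; try lra.
    intros; lra. intros z Hz. apply Hmax. lra.
Qed.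

(** Behind uniqueness for a given [p]: two solutions agree at 1, and a
    positive angle difference anywhere would make [D] positive at 0 and
    nondecreasing. *)
Lemma comparison_nonpos n p D V e L :
  0 < p -> 0 <= n -> 0 <= L -> comparison n p (fun _ => 0) D V e ->
  (forall z, 0 <= z <= 1 -> 0 <= e z -> V z <= L * e z) ->
  D 1 <= 0 -> forall z, 0 < z < 1 -> e z <= 0.
Proof.
  intros Hp Hn HL H HV H1 z Hz. apply Rnot_lt_le. intros Hpos.
  assert (H0 : 0 < D 0) by now apply (comparison_start_positive n p D V e L z).
  assert (D 0 <= D 1); [|lra].
  apply (comparison_increasing n p (fun _ => 0) D V e); auto; intros; lra.
Qed.

(** Behind uniqueness of [p]. Either [D 0 > 0] and [D] is nondecreasing, or
    the positive value forces an interior maximum at positive height. *)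
Lemma comparison_source_contradiction n p r D V e :
  0 < p -> 0 <= n -> (forall z, 0 < z < 1 -> 0 <= r z) ->
  comparison n p r D V e -> D 1 <= 0 ->
  (exists x, 0 < x < 1 /\ 0 < D x) -> False.
Proof.
  intros Hp Hn Hr H H1 [x [Hx Hpos]].
  destruct (Rlt_le_dec 0 (D 0)) as [H0|H0].
  - assert (D 0 <= D 1); [|lra]. apply (comparison_increasing n p r D V e); auto; lra.
  - destruct (attains_max D 0 1) as [m [Hm Hmax]]; [lra|apply H|].
    assert (0 < D m) by (specialize (Hmax x); lra).
    assert (m <> 0) by (intros ->; lra). assert (m <> 1) by (intros ->; lra).
    assert (0 < Rmin m (1 - m)) by (apply Rmin_glb_lt; lra).
    pose proof (Rmin_l m (1 - m)); pose proof (Rmin_r m (1 - m)).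
    apply (comparison_no_interior_max n p r D V e m (Rmin m (1 - m))); auto; try lra.
    intros z Hz. apply Hmax. lra.
Qed.

(** Write [G = p (D - z V) - n V / z], which is the curvature up to the factor
    [c], and [h = z G]. Since [h' = (h + n V - (p z ^ 2 + n) c h) / z], wherever
    [h >= 0] one has [h' >= - K h] with [K] uniform away from 0; so [h exp (K z)] is
    nondecreasing there and [h] cannot come down to 0. Positivity starts arbitrarily
    close to 0 because the slope vanishes at 0 and is positive afterwards. The
    argument includes the end point 1, where the sign of the curvature matters. *)
Lemma curvature_positive n p M D V e c :
  0 < p -> 0 <= n -> comparison n p (fun _ => 0) D V e -> 0 < D 0 ->
  (forall z, continuous V z) ->
  (forall z, 0 < z < 1 ->
     is_derive V z (c z * (p * (D z - z * V z) - n / z * V z))) ->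
  (forall z, 0 < z < 1 -> 0 < c z <= M) ->
  forall z, 0 < z <= 1 -> 0 < p * (D z - z * V z) - n / z * V z.
Proof.
  intros Hp Hn H H0 HVc HVd Hc z1 Hz1.
  assert (HV : forall z, 0 < z < 1 -> 0 < V z).
  { intros z Hz. apply (cmp_pos _ _ _ _ _ _ H).
    apply (comparison_positive n p (fun _ => 0) D V e); auto; intros; lra. }
  assert (HV0 : V 0 = 0) by apply (cmp_zero _ _ _ _ _ _ H), H.
  destruct (mean_value V _ 0 (z1 / 2) ltac:(lra)
              (fun x Hx => HVd x ltac:(lra)) (fun x _ => HVc x)) as [x [Hx Ex]].
  set (h := fun z => p * z * (D z - z * V z) - n * V z).
  assert (Hh : forall z, 0 < z -> p * (D z - z * V z) - n / z * V z = h z / z).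
  { intros z Hz. unfold h. field. lra. }
  assert (Hhx : 0 < h x).
  { rewrite Hh in Ex by lra. specialize (HV (z1 / 2) ltac:(lra)).
    destruct (Hc x ltac:(lra)) as [Hcx _].
    apply Rnot_le_lt. intros Hneg.
    assert (0 < / x) by (apply Rinv_0_lt_compat; lra).
    assert (h x / x <= 0) by (unfold Rdiv; nra).
    assert (c x * (h x / x) <= 0) by nra.
    nra. }
  assert (Hhc : forall z, continuous h z).
  { intros z. unfold h.
    apply (continuous_minus (V := R_NormedModule)).
    - apply (continuous_mult (K := R_AbsRing)).
      + apply (continuous_mult (K := R_AbsRing)); [apply continuous_const|apply continuous_id].
      + apply (continuous_minus (V := R_NormedModule)); [apply H|].
        apply (continuous_mult (K := R_AbsRing)); [apply continuous_id|apply HVc].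
    - apply (continuous_mult (K := R_AbsRing)); [apply continuous_const|apply HVc]. }
  rewrite Hh by lra. apply Rdiv_lt_0_compat; [|lra].
  apply Rnot_le_lt. intros Hneg.
  destruct (first_zero h x z1) as [y [Hy [Ey Ky]]]; [lra|exact Hhc|exact Hhx|exact Hneg|].
  set (K := (p + n) * M / x).
  set (dh := fun z => ((1 - (p * z ^ 2 + n) * c z) * h z + n * V z) / z).
  assert (Hle : h x * exp (K * x) <= h y * exp (K * y)).
  { apply (derive_nonneg_le (fun z => h z * exp (K * z))
             (fun z => (dh z + K * h z) * exp (K * z))); [lra| |].
    - intros z Hz.
      pose proof (cmp_D_derive _ _ _ _ _ _ H z ltac:(lra)) as HDz.
      pose proof (HVd z ltac:(lra)) as HVz.
      assert (Hder : is_derive h z (dh z)).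
      { rewrite Hh in HVz by lra.
        unfold h. auto_derive.
        - repeat split; [now exists (V z)|now exists (c z * (h z / z))
                         |now exists (c z * (h z / z))].
        - rewrite_derive HDz. rewrite_derive HVz.
          unfold dh, h. field. lra. }
      split.
      + auto_derive.
        * now exists (dh z).
        * rewrite_derive Hder. ring.
      + apply Rmult_le_pos; [|left; apply exp_pos].
        assert (Hhz : 0 < h z) by (apply Ky; lra).
        destruct (Hc z ltac:(lra)) as [Hc1 Hc2]. specialize (HV z ltac:(lra)).
        assert (Hz2 : 0 <= z ^ 2 <= 1) by nra.
        assert (Hpz : 0 <= p * z ^ 2 <= p) by nra.
        assert (HK : (p * z ^ 2 + n) * c z / z <= K).
        { unfold K, Rdiv. apply Rmult_le_compat.
          - apply Rmult_le_pos; lra.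
          - left. apply Rinv_0_lt_compat. lra.
          - apply Rmult_le_compat; lra.
          - apply Rinv_le_contravar; lra. }
        replace (dh z + K * h z) with
          (h z / z + n * V z / z + (K - (p * z ^ 2 + n) * c z / z) * h z)
          by (unfold dh; field; lra).
        assert (0 < h z / z) by (apply Rdiv_lt_0_compat; lra).
        assert (0 <= n * V z / z) by (apply Rdiv_le_0_compat; nra).
        assert (0 <= (K - (p * z ^ 2 + n) * c z / z) * h z) by (apply Rmult_le_pos; lra).
        lra.
    - intros z _. apply (continuous_mult (K := R_AbsRing)); [apply Hhc|].
      apply (derive_continuous _ _ (K * exp (K * z))). auto_derive; auto. ring. }
  rewrite Ey in Hle. pose proof (exp_pos (K * x)). nra.
Qed.

(** * Weighted averages along rays *)

(** The solution operator of [z y' + (n + 1) y = f] that is regular at 0: it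
    inverts the singular part of the equation without a boundary term, on both sides
    of 0 at once. *)
Definition average (n : nat) (f : R -> R) (z : R) : R :=
  RInt (fun t => t ^ n * f (t * z)) 0 1.

Lemma average_integrand_continuous n (f : R -> R) z t :
  continuous f (t * z) -> continuous (fun t => t ^ n * f (t * z)) t.
Proof.
  intros H. apply (continuous_mult (K := R_AbsRing)); [apply continuous_pow|].
  apply (continuous_comp (fun t => t * z) f); [|exact H].
  apply (continuous_mult (K := R_AbsRing)); [apply continuous_id|apply continuous_const].
Qed.

Lemma average_ex n (f : R -> R) z :
  (forall x, Rabs x <= Rabs z -> continuous f x) ->
  ex_RInt (fun t => t ^ n * f (t * z)) 0 1.
Proof.
  intros H. apply (ex_RInt_continuous (V := R_CompleteNormedModule)). intros t Ht.
  rewrite Rmin_left, Rmax_right in Ht by lra.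
  apply average_integrand_continuous, H. rewrite Rabs_mult, (Rabs_right t) by lra.
  pose proof (Rabs_pos z). nra.
Qed.

Lemma RInt_pow n : RInt (fun t => t ^ n) 0 1 = / INR (S n).
Proof.
  apply is_RInt_unique.
  replace (/ INR (S n)) with (minus (1 ^ S n / INR (S n)) (0 ^ S n / INR (S n)) : R).
  - apply (is_RInt_derive (V := R_CompleteNormedModule) (fun t => t ^ S n / INR (S n))).
    + intros x _. pose proof (not_0_INR (S n) ltac:(lia)). auto_derive; auto.
      rewrite S_INR in *. simpl pred. change (match n with O => 1 | S _ => INR n + 1 end) with (INR (S n)).
      rewrite S_INR. field. exact H.
    + intros x _. apply continuous_pow.
  - unfold minus, plus, opp; simpl. rewrite pow1. pose proof (not_0_INR (S n) ltac:(lia)).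
    simpl in H. field. exact H.
Qed.

Lemma average_at_0 n f : average n f 0 = f 0 / INR (S n).
Proof.
  unfold average. rewrite (RInt_ext _ (fun t => scal (f 0) (t ^ n))).
  - rewrite (RInt_scal (V := R_CompleteNormedModule)).
    + rewrite RInt_pow. reflexivity.
    + apply (ex_RInt_continuous (V := R_CompleteNormedModule)). intros. apply continuous_pow.
  - intros x _. rewrite Rmult_0_r. unfold scal; simpl; unfold mult; simpl. ring.
Qed.

Lemma average_integral n (f : R -> R) z :
  (forall x, Rabs x <= Rabs z -> continuous f x) ->
  z ^ S n * average n f z = RInt (fun s => s ^ n * f s) 0 z.
Proof.
  intros H.
  pose proof (RInt_comp_lin (V := R_CompleteNormedModule) (fun s => s ^ n * f s) z 0 0 1) as E.
  rewrite Rmult_0_r, Rmult_1_r, !Rplus_0_r in E. rewrite <- E.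
  - unfold average. change (z ^ S n * RInt (fun t => t ^ n * f (t * z)) 0 1)
      with (scal (z ^ S n) (RInt (fun t => t ^ n * f (t * z)) 0 1)).
    rewrite <- (RInt_scal (V := R_CompleteNormedModule)) by now apply average_ex.
    apply RInt_ext. intros x _. unfold scal; simpl; unfold mult; simpl.
    rewrite Rplus_0_r, Rpow_mult_distr, (Rmult_comm z x). ring.
  - apply (ex_RInt_continuous (V := R_CompleteNormedModule)). intros t Ht.
    apply (continuous_mult (K := R_AbsRing)); [apply continuous_pow|]. apply H.
    unfold Rmin, Rmax in Ht. destruct Rle_dec in Ht; unfold Rabs; repeat destruct Rcase_abs; lra.
Qed.

Lemma average_minus n f g z :
  (forall x, Rabs x <= Rabs z -> continuous f x) ->
  (forall x, Rabs x <= Rabs z -> continuous g x) ->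
  average n f z - average n g z = average n (fun s => f s - g s) z.
Proof.
  intros Hf Hg. unfold average.
  rewrite <- (RInt_minus (V := R_CompleteNormedModule)) by now apply average_ex.
  apply RInt_ext. intros x _. unfold minus, plus, opp; simpl. ring.
Qed.

Lemma average_ext n f g z :
  (forall x, Rabs x <= Rabs z -> f x = g x) -> average n f z = average n g z.
Proof.
  intros H. unfold average. apply RInt_ext. intros x Hx.
  rewrite Rmin_left, Rmax_right in Hx by lra. rewrite H; [reflexivity|].
  rewrite Rabs_mult, (Rabs_right x) by lra. pose proof (Rabs_pos z). nra.
Qed.

Lemma average_even n f z : (forall x, f (- x) = f x) -> average n f (- z) = average n f z.
Proof.
  intros H. unfold average. apply RInt_ext. intros x _.
  now rewrite Ropp_mult_distr_r_reverse, H.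
Qed.

Lemma average_le n (f : R -> R) (b : R -> R) z :
  (forall x, Rabs x <= Rabs z -> continuous f x) ->
  (forall x, Rabs x <= Rabs z -> continuous b x) ->
  (forall x, Rabs x <= Rabs z -> Rabs (f x) <= b x) ->
  Rabs (average n f z) <= average n b z.
Proof.
  intros Hf Hb H. unfold average.
  eapply Rle_trans; [apply abs_RInt_le; [lra|now apply average_ex]|].
  apply RInt_le; [lra| |now apply average_ex|].
  - apply (ex_RInt_continuous (V := R_CompleteNormedModule)). intros t Ht.
    rewrite Rmin_left, Rmax_right in Ht by lra.
    apply (continuous_comp (fun t => t ^ n * f (t * z)) Rabs); [|apply continuous_Rabs].
    apply average_integrand_continuous, Hf. rewrite Rabs_mult, (Rabs_right t) by lra.
    pose proof (Rabs_pos z). nra.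
  - intros t Ht. rewrite Rabs_mult, (Rabs_right (t ^ n)).
    + apply Rmult_le_compat_l; [apply pow_le; lra|]. apply H.
      rewrite Rabs_mult, (Rabs_right t) by lra. pose proof (Rabs_pos z). nra.
    + apply Rle_ge, pow_le. lra.
Qed.

Lemma average_continuous n (f : R -> R) r :
  (forall x, Rabs x < r -> continuous f x) ->
  forall z, Rabs z < r -> continuous (average n f) z.
Proof.
  intros Hf z Hz P [e He].
  (* the integrand is uniformly continuous near the compact segment [0, 1] x {z} *)
  set (F := fun y t => t ^ n * f (t * y)).
  destruct (uniform_continuity_2d_1d' F 0 1 z) with (eps := pos_div_2 (mkposreal e (cond_pos e)))
    as [d Hd].
  { intros t Ht. unfold F. apply continuity_2d_pt_mult.
    - apply (continuity_1d_2d_pt_comp (fun t => t ^ n) (fun _ v => v)).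
      + apply continuous_pt, continuous_pow.
      + apply continuity_2d_pt_id2.
    - apply (continuity_1d_2d_pt_comp f (fun u v => v * u)).
      + apply continuous_pt, Hf. rewrite Rabs_mult, (Rabs_right t) by lra.
        pose proof (Rabs_pos z). nra.
      + apply continuity_2d_pt_mult; [apply continuity_2d_pt_id2|apply continuity_2d_pt_id1]. }
  assert (Hm : 0 < Rmin d (r - Rabs z)) by (apply Rmin_glb_lt; [apply cond_pos|lra]).
  exists (mkposreal _ Hm). intros y Hy. apply He.
  unfold ball in *; simpl in *; unfold AbsRing_ball, abs, minus, plus, opp in *; simpl in *.
  pose proof (Rmin_l d (r - Rabs z)); pose proof (Rmin_r d (r - Rabs z)).
  assert (Hyr : Rabs y < r).
  { pose proof (Rabs_shift y z). lra. }
  assert (exf : forall w, Rabs w < r -> ex_RInt (F w) 0 1).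
  { intros w Hw. apply average_ex. intros x Hx. apply Hf. lra. }
  change (Rabs (minus (RInt (F y) 0 1) (RInt (F z) 0 1)) < e).
  rewrite <- (RInt_minus (V := R_CompleteNormedModule)) by auto.
  assert (exm := ex_RInt_minus (V := R_NormedModule) _ _ _ _ (exf y Hyr) (exf z Hz)).
  eapply Rle_lt_trans; [apply abs_RInt_le_const with (M := e / 2); [lra|exact exm|]|].
  - intros t Ht. left. pose proof (cond_pos d). apply Rabs_def2 in Hy.
    apply (Hd t z t y); try lra. rewrite Rminus_diag, Rabs_R0. lra.
  - pose proof (cond_pos e). lra.
Qed.

Lemma average_derive n (f df : R -> R) r :
  (forall x, Rabs x < r -> is_derive f x (df x)) ->
  (forall x, Rabs x < r -> continuous df x) ->
  forall z, Rabs z < r -> is_derive (average n f) z (average (S n) df z).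
Proof.
  intros Hf Hdf z Hz.
  assert (Htz : forall t y, 0 <= t <= 1 -> Rabs y < r -> Rabs (t * y) < r).
  { intros t y Ht Hy. rewrite Rabs_mult, (Rabs_right t) by lra. pose proof (Rabs_pos y). nra. }
  assert (HD : forall t y, Rabs (t * y) < r ->
            is_derive (fun u => t ^ n * f (t * u)) y (t ^ S n * df (t * y))).
  { intros t y Hy. specialize (Hf _ Hy).
    auto_derive; [now exists (df (t * y))|].
    rewrite_derive Hf. simpl. ring. }
  eapply derive_eq.
  - apply (is_derive_RInt_param (fun y t => t ^ n * f (t * y))).
    + apply filter_imp with (2 := locally_abs_lt r z Hz). intros y Hy t Ht.
      rewrite Rmin_left, Rmax_right in Ht by lra.
      exists (t ^ S n * df (t * y)). apply HD. auto.
    + intros t Ht. rewrite Rmin_left, Rmax_right in Ht by lra.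
      assert (Hc : continuity_2d_pt (fun u v => v ^ S n * df (v * u)) z t).
      { apply continuity_2d_pt_mult.
        - apply (continuity_1d_2d_pt_comp (fun t => t ^ S n) (fun _ v => v)).
          + apply continuous_pt, continuous_pow.
          + apply continuity_2d_pt_id2.
        - apply (continuity_1d_2d_pt_comp df (fun u v => v * u)).
          + apply continuous_pt, Hdf, Htz; auto.
          + apply continuity_2d_pt_mult; [apply continuity_2d_pt_id2|apply continuity_2d_pt_id1]. }
      apply continuity_2d_pt_ext_loc with (2 := Hc).
      assert (Hl : continuity_2d_pt (fun u v => v * u) z t)
        by (apply continuity_2d_pt_mult; [apply continuity_2d_pt_id2|apply continuity_2d_pt_id1]).
      assert (He : 0 < r - Rabs (t * z)) by (specialize (Htz t z Ht Hz); lra).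
      apply locally_2d_impl with (2 := Hl (mkposreal _ He)).
      apply locally_2d_forall. intros u v Huv. simpl in Huv.
      symmetry. apply is_derive_unique, HD.
      pose proof (Rabs_triang (v * u - t * z) (t * z)).
      replace (v * u - t * z + t * z) with (v * u) in H by ring. lra.
    + apply filter_imp with (2 := locally_abs_lt r z Hz). intros y Hy.
      apply average_ex. intros x Hx. apply derive_continuous with (df x), Hf. lra.
  - apply RInt_ext. intros t Ht. rewrite Rmin_left, Rmax_right in Ht by lra.
    apply is_derive_unique, HD, Htz; auto. lra.
Qed.

(** The regularising property: [z * average n f z] is differentiable, at 0
    too, when [f] is merely continuous. *)
Lemma average_moment_derive n (f : R -> R) r :
  (forall x, Rabs x < r -> continuous f x) ->
  forall z, Rabs z < r ->
  is_derive (fun z => z * average n f z) z (f z - INR n * average n f z).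
Proof.
  intros Hf z Hz. destruct (Req_dec z 0) as [->|H0].
  - eapply derive_eq.
    + apply (derive_mult_vanishing (fun x => x) (average n f) 1); [|reflexivity|].
      * apply (is_derive_id (K := R_AbsRing)).
      * now apply average_continuous with r.
    + rewrite average_at_0, S_INR. pose proof (pos_INR n). field. lra.
  - assert (HI : is_derive (fun y => RInt (fun s => s ^ n * f s) 0 y) z (z ^ n * f z)).
    { apply (is_derive_RInt (V := R_NormedModule) (fun s => s ^ n * f s) _ 0).
      - apply filter_imp with (2 := locally_abs_lt r z Hz). intros y Hy.
        apply (RInt_correct (V := R_CompleteNormedModule)),
          (ex_RInt_continuous (V := R_CompleteNormedModule)). intros x Hx.
        apply (continuous_mult (K := R_AbsRing)); [apply continuous_pow|]. apply Hf.
        unfold Rmin, Rmax in Hx. revert Hy. destruct Rle_dec in Hx; unfold Rabs; repeat destruct Rcase_abs; lra.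
      - apply (continuous_mult (K := R_AbsRing)); [apply continuous_pow|now apply Hf]. }
    assert (Hzn : z ^ n <> 0) by now apply pow_nonzero.
    assert (HE := average_integral n f z ltac:(intros; apply Hf; lra)).
    apply (is_derive_ext_loc (fun y => RInt (fun s => s ^ n * f s) 0 y / y ^ n)).
    + assert (Hd : 0 < Rmin (Rabs z) (r - Rabs z)) by (apply Rmin_glb_lt; [now apply Rabs_pos_lt|lra]).
      exists (mkposreal _ Hd). intros y Hy.
      unfold ball in Hy; simpl in Hy; unfold AbsRing_ball, abs, minus, plus, opp in Hy; simpl in Hy.
      pose proof (Rmin_l (Rabs z) (r - Rabs z)); pose proof (Rmin_r (Rabs z) (r - Rabs z)).
      assert (y <> 0).
      { intros ->. rewrite Rplus_0_l, Rabs_Ropp in Hy. lra. }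
      pose proof (Rabs_shift y z) as Ht.
      rewrite <- average_integral by (intros; apply Hf; lra).
      simpl. field. now apply pow_nonzero.
    + eapply derive_eq.
      * apply (is_derive_div (fun y => RInt (fun s => s ^ n * f s) 0 y) (fun y => y ^ n) z
                 (z ^ n * f z) (INR n * z ^ pred n)); [exact HI| |exact Hzn].
        auto_derive; auto. ring.
      * rewrite <- HE. destruct n as [|n].
        -- simpl. field.
        -- simpl pred. rewrite <- !tech_pow_Rmult. field. split; [now apply pow_nonzero|exact H0].
Qed.

(** * The truncated tangent *)

(** The tangent is continued linearly outside [-PI/4, PI/4]. It becomes
    globally Lipschitz, and the solutions looked for, whose slope is at most
    [k < 1], never reach the region where it is altered. Defining the derivative
    first makes differentiability at the junction points automatic. *)
Definition trunc_tan_slope (x : R) : R := 1 + (tan (clamp (- (PI / 4)) (PI / 4) x)) ^ 2.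
Definition trunc_tan (x : R) : R := RInt trunc_tan_slope 0 x.
(** This is [trunc_tan x / x - 1], in a form that is continuous at 0. *)
Definition trunc_tan_excess (x : R) : R := average 0 (fun s => trunc_tan_slope s - 1) x.

Lemma clamp_quarter x : - (PI / 4) <= clamp (- (PI / 4)) (PI / 4) x <= PI / 4.
Proof. pose proof PI_RGT_0. apply clamp_range. lra. Qed.

Lemma trunc_tan_slope_range x : 1 <= trunc_tan_slope x <= 2.
Proof.
  unfold trunc_tan_slope. pose proof (clamp_quarter x) as H. set (y := clamp _ _ _) in *.
  assert (tan y <= 1) by (rewrite <- tan_PI4; apply tan_incr_1; lra).
  assert (-1 <= tan y).
  { replace (-1) with (- (1)) by ring. rewrite <- tan_PI4, <- tan_neg. apply tan_incr_1; lra. }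
  nra.
Qed.

Lemma trunc_tan_slope_even x : trunc_tan_slope (- x) = trunc_tan_slope x.
Proof.
  unfold trunc_tan_slope. pose proof PI_RGT_0.
  replace (clamp (- (PI / 4)) (PI / 4) (- x)) with (- clamp (- (PI / 4)) (PI / 4) x).
  - rewrite tan_neg. ring.
  - unfold clamp, Rmax, Rmin. repeat destruct Rle_dec; lra.
Qed.

Lemma trunc_tan_slope_continuous x : continuous trunc_tan_slope x.
Proof.
  unfold trunc_tan_slope. pose proof (clamp_quarter x) as H. pose proof PI_RGT_0.
  apply (continuous_comp (clamp (- (PI / 4)) (PI / 4)) (fun y => 1 + tan y ^ 2)).
  - apply clamp_continuous.
  - assert (Hc : cos (clamp (- (PI / 4)) (PI / 4) x) <> 0).
    { apply Rgt_not_eq, cos_gt_0; lra. }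
    pose proof (is_derive_tan _ Hc) as Hd.
    apply (ex_derive_continuous (V := R_NormedModule)). auto_derive. now eexists; apply Hd.
Qed.

Lemma trunc_tan_derive x : is_derive trunc_tan x (trunc_tan_slope x).
Proof. apply primitive_derive. intros y. apply trunc_tan_slope_continuous. Qed.

Lemma trunc_tan_continuous x : continuous trunc_tan x.
Proof. eapply derive_continuous, trunc_tan_derive. Qed.

Lemma trunc_tan_0 : trunc_tan 0 = 0.
Proof. apply (RInt_point (V := R_CompleteNormedModule)). Qed.

Lemma trunc_tan_odd x : trunc_tan (- x) = - trunc_tan x.
Proof.
  unfold trunc_tan. rewrite RInt_reflect by apply trunc_tan_slope_continuous. f_equal.
  apply RInt_ext. intros y _. apply trunc_tan_slope_even.
Qed.

Lemma trunc_tan_increment x y : x <= y -> y - x <= trunc_tan y - trunc_tan x <= 2 * (y - x).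
Proof.
  intros [H|<-]; [|lra].
  destruct (mean_value trunc_tan trunc_tan_slope x y H) as [c [_ E]].
  - intros z _. apply trunc_tan_derive.
  - intros z _. apply trunc_tan_continuous.
  - pose proof (trunc_tan_slope_range c). rewrite E. nra.
Qed.

Lemma trunc_tan_increasing x y : x < y -> trunc_tan x < trunc_tan y.
Proof. intros H. pose proof (trunc_tan_increment x y). lra. Qed.

Lemma trunc_tan_abs_minus x y :
  Rabs (x - y) <= Rabs (trunc_tan x - trunc_tan y) <= 2 * Rabs (x - y).
Proof.
  destruct (Rle_dec x y) as [H|H].
  - pose proof (trunc_tan_increment x y H). rewrite !(Rabs_left1 (_ - _)) by lra. lra.
  - pose proof (trunc_tan_increment y x). rewrite !(Rabs_right (_ - _)) by lra. lra.
Qed.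

Lemma trunc_tan_lipschitz_excess x y : Rabs (trunc_tan x - x - (trunc_tan y - y)) <= Rabs (x - y).
Proof.
  destruct (Rle_dec x y) as [H|H].
  - pose proof (trunc_tan_increment x y H). rewrite (Rabs_left1 (x - y)) by lra. apply Rabs_le. lra.
  - pose proof (trunc_tan_increment y x). rewrite (Rabs_right (x - y)) by lra. apply Rabs_le. lra.
Qed.

Lemma trunc_tan_slope_tan x : Rabs x < PI / 4 -> trunc_tan_slope x = 1 + tan x ^ 2.
Proof. intros H. apply Rabs_def2 in H. unfold trunc_tan_slope. rewrite clamp_id; lra. Qed.

Lemma trunc_tan_tan x : Rabs x < PI / 4 -> trunc_tan x = tan x.
Proof.
  intros Hx. apply Rminus_diag_uniq.
  rewrite (constant_of_derive_0 (fun x => trunc_tan x - tan x) (PI / 4)); auto.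
  - rewrite trunc_tan_0, tan_0. ring.
  - intros y Hy. eapply derive_eq.
    + apply (is_derive_minus (V := R_NormedModule)); [apply trunc_tan_derive|].
      apply is_derive_tan. apply Rabs_def2 in Hy.
      apply Rgt_not_eq, cos_gt_0; pose proof PI_RGT_0; lra.
    + rewrite trunc_tan_slope_tan by assumption. unfold minus, plus, opp; simpl. ring.
Qed.

Lemma atan_small x : Rabs x < 1 -> Rabs (atan x) < PI / 4.
Proof.
  intros H. apply Rabs_def2 in H. pose proof PI_RGT_0.
  assert (E : atan 1 = PI / 4) by (rewrite <- tan_PI4; apply atan_tan; lra).
  apply Rabs_def1.
  - rewrite <- E. apply atan_increasing. lra.
  - rewrite <- E, <- atan_opp. apply atan_increasing. lra.
Qed.

Lemma trunc_tan_atan x : Rabs x < 1 -> trunc_tan (atan x) = x.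
Proof. intros H. rewrite trunc_tan_tan by now apply atan_small. apply tan_atan. Qed.

Lemma excess_weight_continuous x : continuous (fun s => trunc_tan_slope s - 1) x.
Proof.
  apply (continuous_minus (V := R_NormedModule)); [apply trunc_tan_slope_continuous|apply continuous_const].
Qed.

Lemma trunc_tan_excess_continuous x : continuous trunc_tan_excess x.
Proof.
  apply (average_continuous 0 _ (Rabs x + 1)); [|lra].
  intros. apply excess_weight_continuous.
Qed.

Lemma trunc_tan_excess_0 : trunc_tan_excess 0 = 0.
Proof.
  unfold trunc_tan_excess. rewrite average_at_0. unfold trunc_tan_slope.
  pose proof PI_RGT_0. rewrite clamp_id, tan_0 by lra. simpl. lra.
Qed.

Lemma trunc_tan_excess_even x : trunc_tan_excess (- x) = trunc_tan_excess x.
Proof. apply average_even. intros y. now rewrite trunc_tan_slope_even. Qed.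

Lemma trunc_tan_excess_spec x : x * trunc_tan_excess x = trunc_tan x - x.
Proof.
  replace (x * trunc_tan_excess x) with (x ^ 1 * average 0 (fun s => trunc_tan_slope s - 1) x)
    by (unfold trunc_tan_excess; ring).
  rewrite average_integral by (intros; apply excess_weight_continuous).
  rewrite (RInt_ext _ (fun s => minus (trunc_tan_slope s) 1)).
  - rewrite (RInt_minus (V := R_CompleteNormedModule) trunc_tan_slope (fun _ => 1)).
    + rewrite RInt_const. unfold minus, plus, opp, scal; simpl; unfold mult; simpl.
      unfold trunc_tan. ring.
    + apply (ex_RInt_continuous (V := R_CompleteNormedModule)). intros; apply trunc_tan_slope_continuous.
    + apply ex_RInt_const.
  - intros y _. unfold minus, plus, opp; simpl. ring.
Qed.

(** For [s <> 0] the left side is a difference quotient of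
    [trunc_tan x - x], whose derivative lies in [0, 1]. The constant 1 is what the
    contraction below requires. *)
Lemma trunc_tan_excess_lipschitz s y1 y2 :
  Rabs (y1 * trunc_tan_excess (s * y1) - y2 * trunc_tan_excess (s * y2)) <= Rabs (y1 - y2).
Proof.
  destruct (Req_dec s 0) as [->|Hs].
  - rewrite !Rmult_0_l, trunc_tan_excess_0, !Rmult_0_r, Rminus_diag, Rabs_R0. apply Rabs_pos.
  - apply Rmult_le_reg_l with (Rabs s); [now apply Rabs_pos_lt|].
    rewrite <- !Rabs_mult.
    replace (s * (y1 * trunc_tan_excess (s * y1) - y2 * trunc_tan_excess (s * y2))) with
      (s * y1 * trunc_tan_excess (s * y1) - s * y2 * trunc_tan_excess (s * y2)) by ring.
    rewrite !trunc_tan_excess_spec, Rmult_minus_distr_l. apply trunc_tan_lipschitz_excess.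
Qed.

(** * Contractions in a weighted norm *)

(** The pointwise limit of the Picard iterates started at 0; being explicit,
    it depends on the parameters as a function. *)
Definition fixpoint (T : (R -> R) -> R -> R) (z : R) : R :=
  real (Lim_seq (fun j => Nat.iter j T (fun _ => 0) z)).

Definition contracts (T : (R -> R) -> R -> R) (W : R -> R) (q : R) : Prop :=
  (forall u, (forall z, continuous u z) -> forall z, continuous (T u) z) /\
  (forall u v d, (forall z, continuous u z) -> (forall z, continuous v z) -> 0 <= d ->
     (forall z, Rabs (u z - v z) <= d * W z) ->
     forall z, Rabs (T u z - T v z) <= q * d * W z).

Lemma geometric_small q d : 0 <= q < 1 -> 0 < d ->
  forall c, 0 <= c -> exists j, forall m, (j <= m)%nat -> c * q ^ m < d.
Proof.
  intros Hq Hd c Hc.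
  destruct (pow_lt_1_zero q ltac:(rewrite Rabs_right; lra) (d / (c + 1))) as [j Hj].
  { apply Rdiv_lt_0_compat; lra. }
  exists j. intros m Hm. specialize (Hj m Hm).
  assert (0 <= q ^ m) by (apply pow_le; lra).
  rewrite Rabs_right in Hj by lra.
  apply Rle_lt_trans with ((c + 1) * q ^ m); [nra|].
  apply Rlt_le_trans with ((c + 1) * (d / (c + 1))).
  - apply Rmult_lt_compat_l; lra.
  - right. field. lra.
Qed.

Lemma zero_of_geometric q c x : 0 <= q < 1 -> 0 <= c ->
  (forall j : nat, Rabs x <= c * q ^ j) -> x = 0.
Proof.
  intros Hq Hc H. destruct (Req_dec x 0) as [|Hx]; auto. exfalso.
  destruct (geometric_small q (Rabs x) Hq (Rabs_pos_lt x Hx) c Hc) as [j Hj].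
  specialize (H j). specialize (Hj j (le_n j)). lra.
Qed.

Section Contraction.

Context (T : (R -> R) -> R -> R) (W : R -> R) (q b : R).
Context (Hq : 0 <= q < 1) (HW : forall z, 0 <= W z) (Hb : 0 <= b).
Context (HT : contracts T W q) (HT0 : forall z, Rabs (T (fun _ => 0) z) <= b * W z).
Context (HWb : forall r, exists B, forall z, Rabs z < r -> W z <= B).

Let it (j : nat) : R -> R := Nat.iter j T (fun _ => 0).

Lemma iterate_continuous j z : continuous (it j) z.
Proof.
  revert z. induction j as [|j IH]; intros z.
  - apply continuous_const.
  - apply (proj1 HT). exact IH.
Qed.

Lemma iterate_step j z : Rabs (it (S j) z - it j z) <= b * q ^ j * W z.
Proof.
  revert z. induction j as [|j IH]; intros z.
  - simpl. rewrite Rminus_0_r. specialize (HT0 z). lra.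
  - replace (b * q ^ S j * W z) with (q * (b * q ^ j) * W z) by (simpl; ring).
    apply (proj2 HT).
    + intros; apply (iterate_continuous (S j)).
    + intros; apply (iterate_continuous j).
    + apply Rmult_le_pos; [exact Hb|]. apply pow_le. lra.
    + exact IH.
Qed.

Lemma iterate_tail j m z : Rabs (it (j + m) z - it j z) <= b / (1 - q) * q ^ j * W z.
Proof.
  assert (K : Rabs (it (j + m) z - it j z) <= b / (1 - q) * (q ^ j - q ^ (j + m)) * W z).
  { induction m as [|m IH].
    - rewrite Nat.add_0_r, !Rminus_diag, Rabs_R0, Rmult_0_r, Rmult_0_l. lra.
    - replace (it (j + S m) z - it j z) with
        ((it (S (j + m)) z - it (j + m) z) + (it (j + m) z - it j z))
        by (rewrite Nat.add_succ_r; ring).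
      eapply Rle_trans; [apply Rabs_triang|].
      pose proof (iterate_step (j + m) z).
      replace (b / (1 - q) * (q ^ j - q ^ (j + S m)) * W z) with
        (b * q ^ (j + m) * W z + b / (1 - q) * (q ^ j - q ^ (j + m)) * W z).
      + lra.
      + rewrite Nat.add_succ_r. simpl. field. lra. }
  eapply Rle_trans; [exact K|].
  apply Rmult_le_compat_r; [apply HW|]. apply Rmult_le_compat_l.
  - apply Rdiv_le_0_compat; lra.
  - assert (0 <= q ^ (j + m)) by (apply pow_le; lra). lra.
Qed.

Lemma fixpoint_limit z : is_lim_seq (fun j => it j z) (fixpoint T z).
Proof.
  unfold fixpoint. apply Lim_seq_correct'. apply ex_lim_seq_cauchy_corr.
  intros e.
  destruct (geometric_small q (e / 2) Hq ltac:(pose proof (cond_pos e); lra)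
    (b / (1 - q) * W z)) as [N HN].
  { apply Rmult_le_pos; [apply Rdiv_le_0_compat; lra|apply HW]. }
  assert (K : forall j, (N <= j)%nat -> Rabs (it j z - it N z) < e / 2).
  { intros j Hj. replace j with (N + (j - N))%nat by lia.
    eapply Rle_lt_trans; [apply iterate_tail|].
    specialize (HN N (le_n N)). lra. }
  exists N. intros j m Hj Hm. change (Rabs (it j z - it m z) < e).
  replace (it j z - it m z) with ((it j z - it N z) + - (it m z - it N z)) by ring.
  eapply Rle_lt_trans; [apply Rabs_triang|]. rewrite Rabs_Ropp.
  pose proof (K j Hj). pose proof (K m Hm). lra.
Qed.

Lemma fixpoint_close j z : Rabs (fixpoint T z - it j z) <= b / (1 - q) * q ^ j * W z.
Proof.
  assert (L : is_lim_seq (fun m => Rabs (it (m + j) z - it j z)) (Rabs (fixpoint T z - it j z))).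
  { apply (is_lim_seq_abs _ (Finite (fixpoint T z - it j z))). apply is_lim_seq_minus'.
    - apply is_lim_seq_incr_n with (u := fun m => it m z). apply fixpoint_limit.
    - apply is_lim_seq_const. }
  refine (is_lim_seq_le (fun m => Rabs (it (m + j) z - it j z))
           (fun _ => b / (1 - q) * q ^ j * W z) (Finite _) (Finite _) _ L _).
  - intros m. rewrite Nat.add_comm. apply iterate_tail.
  - apply is_lim_seq_const.
Qed.

Lemma fixpoint_bound z : Rabs (fixpoint T z) <= b / (1 - q) * W z.
Proof.
  pose proof (fixpoint_close 0 z) as H. simpl in H. rewrite Rminus_0_r in H. lra.
Qed.

(** The iterates converge uniformly where the weight is bounded. *)
Lemma fixpoint_continuous z : continuous (fixpoint T) z.
Proof.
  apply continuity_pt_filterlim.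
  assert (Hr : 0 < Rabs z + 1) by (pose proof (Rabs_pos z); lra).
  apply (CVU_continuity it (fixpoint T) 0 (mkposreal _ Hr)).
  - intros e He. destruct (HWb (Rabs z + 1)) as [B HB].
    assert (HB0 : 0 <= B).
    { apply Rle_trans with (W z); [apply HW|]. apply HB. lra. }
    destruct (geometric_small q e Hq He (b / (1 - q) * B)) as [N HN].
    { apply Rmult_le_pos; [apply Rdiv_le_0_compat; lra|exact HB0]. }
    exists N. intros m y Hm Hy. unfold Boule in Hy. simpl in Hy. rewrite Rminus_0_r in Hy.
    eapply Rle_lt_trans; [apply fixpoint_close|].
    eapply Rle_lt_trans; [|apply (HN m Hm)].
    replace (b / (1 - q) * B * q ^ m) with (b / (1 - q) * q ^ m * B) by ring.
    apply Rmult_le_compat_l; [|now apply HB].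
    apply Rmult_le_pos; [apply Rdiv_le_0_compat; lra|apply pow_le; lra].
  - intros j y _. apply continuous_pt, iterate_continuous.
  - unfold Boule. simpl. rewrite Rminus_0_r. lra.
Qed.

Lemma fixpoint_fixed z : T (fixpoint T) z = fixpoint T z.
Proof.
  apply Rminus_diag_uniq.
  assert (0 <= b / (1 - q)) by (apply Rdiv_le_0_compat; lra).
  apply (zero_of_geometric q (2 * (b / (1 - q)) * W z)); [exact Hq| |].
  - apply Rmult_le_pos; [lra|apply HW].
  - intros j. replace (T (fixpoint T) z - fixpoint T z) with
      ((T (fixpoint T) z - it (S j) z) + - (fixpoint T z - it (S j) z)) by ring.
    eapply Rle_trans; [apply Rabs_triang|]. rewrite Rabs_Ropp.
    assert (Hqj : 0 <= q ^ j) by (apply pow_le; lra).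
    assert (H1 : Rabs (T (fixpoint T) z - it (S j) z) <= q * (b / (1 - q) * q ^ j) * W z).
    { apply (proj2 HT).
      - apply fixpoint_continuous.
      - apply iterate_continuous.
      - apply Rmult_le_pos; lra.
      - apply fixpoint_close. }
    pose proof (fixpoint_close (S j) z) as H2. simpl pow in H2.
    assert (0 <= b / (1 - q) * q ^ j * W z).
    { apply Rmult_le_pos; [apply Rmult_le_pos; lra|apply HW]. }
    nra.
Qed.

Lemma fixpoint_even :
  (forall u, (forall z, continuous u z) ->
     (forall z, u (- z) = u z) -> forall z, T u (- z) = T u z) ->
  forall z, fixpoint T (- z) = fixpoint T z.
Proof.
  intros He z. unfold fixpoint. f_equal. apply Lim_seq_ext. intros j. revert z.
  induction j as [|j IH]; intros z; [reflexivity|].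
  simpl. apply He; [apply (iterate_continuous j)|exact IH].
Qed.

End Contraction.

(** The hypothesis on [e] says that the map sending an error bound [e] to
    [d + q e] improves any error bound; iterating it from the crude bound [b] leads to
    its fixed point. *)
Lemma contraction_stability (T : (R -> R) -> R -> R) (W u v : R -> R) q b d :
  0 <= q < 1 -> (forall z, 0 <= W z) -> 0 <= b -> 0 <= d ->
  (forall e, 0 <= e -> (forall z, Rabs (u z - v z) <= e * W z) ->
     forall z, Rabs (u z - v z) <= (d + q * e) * W z) ->
  (forall z, Rabs (u z - v z) <= b * W z) ->
  forall z, Rabs (u z - v z) <= d / (1 - q) * W z.
Proof.
  intros Hq HW Hb Hd Himp H0.
  assert (K : forall j z, Rabs (u z - v z) <= (d / (1 - q) + b * q ^ j) * W z).
  { assert (0 <= d / (1 - q)) by (apply Rdiv_le_0_compat; lra).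
    induction j as [|j IH]; intros z.
    - simpl. specialize (H0 z). specialize (HW z). nra.
    - assert (0 <= q ^ j) by (apply pow_le; lra).
      eapply Rle_trans; [apply (Himp (d / (1 - q) + b * q ^ j)); [|exact IH]|].
      + assert (0 <= b * q ^ j) by (apply Rmult_le_pos; lra). lra.
      + right. simpl. field. lra. }
  intros z. apply Rnot_lt_le. intros Hlt.
  destruct (geometric_small q (Rabs (u z - v z) - d / (1 - q) * W z) Hq ltac:(lra) (b * W z))
    as [j Hj]; [apply Rmult_le_pos; auto|].
  specialize (Hj j (le_n j)). specialize (K j z). lra.
Qed.

(** * The singular integral equation *)

(** The rate is quadratic in [z] because the Lipschitz constant of the slope
    in the unknown grows like [z]; the kernels met below then have exact primitives and
    the contraction holds on the whole line. *)
Definition weight (L z : R) : R := exp (L * z ^ 2).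

Lemma weight_pos L z : 0 < weight L z.
Proof. apply exp_pos. Qed.

Lemma weight_ge_1 L z : 0 <= L -> 1 <= weight L z.
Proof.
  intros H. unfold weight. pose proof (pow2_ge_0 z).
  pose proof (exp_ineq1_le (L * z ^ 2)). assert (0 <= L * z ^ 2) by nra. lra.
Qed.

Lemma weight_le L x z : 0 <= L -> Rabs x <= Rabs z -> weight L x <= weight L z.
Proof.
  intros HL H. unfold weight.
  assert (x ^ 2 <= z ^ 2) by (rewrite <- (pow2_abs x), <- (pow2_abs z); pose proof (Rabs_pos x); nra).
  destruct (Req_dec (L * x ^ 2) (L * z ^ 2)) as [->|]; [lra|].
  left. apply exp_increasing. nra.
Qed.

Lemma weight_continuous L z : continuous (weight L) z.
Proof. apply (ex_derive_continuous (V := R_NormedModule)). unfold weight. auto_derive. exact I. Qed.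

(** A term bounded by [A] times the weight only gains the factor
    [1 / (n + 1)] from the average, whereas a term carrying [1 / L + 2 x ^ 2] gains
    [2 / L], as small as desired. *)
Lemma average_weight_le n L A B (f : R -> R) z :
  0 < L -> 0 <= A -> 0 <= B ->
  (forall x, continuous f x) ->
  (forall x, Rabs (f x) <= (A + B * (1 / L + 2 * x ^ 2)) * weight L x) ->
  Rabs (average n f z) <= (A / INR (S n) + 2 * B / L) * weight L z.
Proof.
  intros HL HA HB Hf H.
  pose proof (lt_0_INR (S n) ltac:(lia)) as Hn.
  set (b := fun x => (A + B * (1 / L + 2 * x ^ 2)) * weight L x) in *.
  assert (Hb : forall x, continuous b x).
  { intros x. apply (ex_derive_continuous (V := R_NormedModule)). unfold b, weight.
    auto_derive. exact I. }
  eapply Rle_trans; [apply (average_le n f b); auto|].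
  set (W := weight L z).
  (* [P] is a primitive of [g], an upper bound of the integrand: replace the weight by
     its value at [z], except in the quadratic term, where [2 t z ^ 2] times the weight
     is [1 / L] times its derivative in [t] *)
  set (P := fun t => A * W * (t ^ S n / INR (S n)) + B * W / L * t + B / L * exp (L * (t * z) ^ 2)).
  set (g := fun t => A * W * t ^ n + B * W / L + B * (2 * t * z ^ 2) * weight L (t * z)).
  assert (HI : is_RInt g 0 1 (minus (P 1) (P 0))).
  { apply (is_RInt_derive (V := R_CompleteNormedModule) P g).
    - intros t _. unfold P, g. eapply derive_eq.
      + apply (is_derive_plus (V := R_NormedModule) (fun t => A * W * (t ^ S n / INR (S n)) + B * W / L * t)).
        * apply (is_derive_plus (V := R_NormedModule) (fun t => A * W * (t ^ S n / INR (S n)))).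
          -- apply (is_derive_scal (fun t => t ^ S n / INR (S n)) t (A * W) (t ^ n)).
             eapply derive_eq.
             ++ apply (is_derive_scal_l (K := R_AbsRing) (V := R_NormedModule) (fun t => t ^ S n) t (INR (S n) * t ^ n) (/ INR (S n))).
                eapply derive_eq; [apply is_derive_pow, (is_derive_id (K := R_AbsRing))|].
                simpl pred. change (one : R_AbsRing) with 1. rewrite Rmult_1_r. reflexivity.
             ++ unfold scal; simpl; unfold mult; simpl. change (match n with O => 1 | S _ => INR n + 1 end) with (INR (S n)). field. lra.
          -- apply (is_derive_scal (fun t => t) t (B * W / L) 1), (is_derive_id (K := R_AbsRing)).
        * apply (is_derive_scal (fun t => exp (L * (t * z) ^ 2)) t (B / L)
                   (L * (2 * t * z ^ 2) * weight L (t * z))).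
          unfold weight. auto_derive; auto. simpl. ring.
      + unfold plus; simpl. field. lra.
    - intros t _. apply (ex_derive_continuous (V := R_NormedModule)). unfold g, weight.
      auto_derive. exact I. }
  apply Rle_trans with (minus (P 1) (P 0)).
  - rewrite <- (is_RInt_unique _ _ _ _ HI).
    apply RInt_le; [lra|apply average_ex; auto|now eexists; apply HI|].
    intros t Ht. unfold b, g.
    assert (Hw : weight L (t * z) <= W).
    { apply weight_le; [lra|]. rewrite Rabs_mult, (Rabs_right t) by lra.
      pose proof (Rabs_pos z). nra. }
    pose proof (weight_pos L (t * z)) as Hw0.
    assert (Ht0 : 0 <= t ^ n) by (apply pow_le; lra).
    assert (Ht1 : t ^ n <= 1) by (rewrite <- (pow1 n); apply pow_incr; lra).
    set (w := weight L (t * z)) in *.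
    replace (t ^ n * ((A + B * (1 / L + 2 * (t * z) ^ 2)) * w)) with
      (A * (w * t ^ n) + B / L * (t ^ n * w) + B * w * (t ^ n * t * (2 * t * z ^ 2))) by (field; lra).
    assert (A * (w * t ^ n) <= A * (W * t ^ n)).
    { apply Rmult_le_compat_l; [lra|]. now apply Rmult_le_compat_r. }
    assert (0 <= B / L) by (apply Rdiv_le_0_compat; lra).
    assert (B / L * (t ^ n * w) <= B / L * W).
    { apply Rmult_le_compat_l; [lra|]. nra. }
    assert (B * w * (t ^ n * t * (2 * t * z ^ 2)) <= B * w * (1 * (2 * t * z ^ 2))).
    { apply Rmult_le_compat_l; [apply Rmult_le_pos; lra|].
      apply Rmult_le_compat_r; [|nra]. pose proof (pow2_ge_0 z). nra. }
    replace (B * W / L) with (B / L * W) by (field; lra). nra.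
  - unfold P, minus, plus, opp; simpl. fold W.
    rewrite pow1, !Rmult_1_l, !Rmult_0_l, !Rmult_0_r, exp_0.
    change (match n with O => 1 | S _ => INR n + 1 end) with (INR (S n)).
    fold (weight L z).
    replace (exp (L * (z * (z * 1)))) with W by reflexivity.
    assert (0 <= B / L) by (apply Rdiv_le_0_compat; lra).
    replace ((A / INR (S n) + 2 * B / L) * W) with (A * W * (1 / INR (S n)) + 2 * (B / L * W))
      by (field; lra).
    replace (B * W / L) with (B / L * W) by (field; lra).
    unfold Rdiv at 4. rewrite Rmult_0_l. lra.
Qed.

Definition height (a : R) (u : R -> R) (z : R) : R := a + RInt (fun s => trunc_tan (s * u s)) 0 z.
(** The height at which the tangent line at [z] meets the axis [z = 0]. *)
Definition intercept (a : R) (u : R -> R) (z : R) : R := height a u z - z * trunc_tan (z * u z).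
(** With the unknown [u = theta / z], where theta is the angle, the equation
    [theta' = p (phi - z phi') - n phi' / z] becomes [z u' + (n + 1) u = forcing]: the
    linear part of [phi' = trunc_tan theta] is moved to the left and the excess stays
    on the right. *)
Definition forcing (n : nat) (p a : R) (u : R -> R) (s : R) : R :=
  p * intercept a u s - INR n * (u s * trunc_tan_excess (s * u s)).
Definition picard (n : nat) (p a : R) (u : R -> R) : R -> R := average n (forcing n p a u).

Lemma angle_continuous (u : R -> R) z : (forall z, continuous u z) -> continuous (fun s => s * u s) z.
Proof. intros H. apply (continuous_mult (K := R_AbsRing)); [apply continuous_id|apply H]. Qed.

Lemma slope_continuous (u : R -> R) z :
  (forall z, continuous u z) -> continuous (fun s => trunc_tan (s * u s)) z.
Proof.
  intros H. apply (continuous_comp (fun s => s * u s) trunc_tan).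
  - now apply angle_continuous.
  - apply trunc_tan_continuous.
Qed.

Lemma height_derive a u z :
  (forall z, continuous u z) -> is_derive (height a u) z (trunc_tan (z * u z)).
Proof.
  intros H. eapply derive_eq.
  - apply (is_derive_plus (V := R_NormedModule) (fun _ => a) (RInt (fun s => trunc_tan (s * u s)) 0)).
    + apply (is_derive_const (K := R_AbsRing) (V := R_NormedModule)).
    + apply (primitive_derive (fun s => trunc_tan (s * u s))). intros. now apply slope_continuous.
  - unfold plus, zero; simpl. ring.
Qed.

Lemma height_continuous a u z : (forall z, continuous u z) -> continuous (height a u) z.
Proof. intros H. eapply derive_continuous, height_derive, H. Qed.

Lemma height_0 a u : height a u 0 = a.
Proof.
  unfold height. rewrite (RInt_point (V := R_CompleteNormedModule)).
  unfold zero; simpl. ring.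
Qed.

Lemma intercept_continuous a u z : (forall z, continuous u z) -> continuous (intercept a u) z.
Proof.
  intros H. apply (continuous_minus (V := R_NormedModule)).
  - now apply height_continuous.
  - apply (continuous_mult (K := R_AbsRing)); [apply continuous_id|now apply slope_continuous].
Qed.

Lemma forcing_continuous n p a u z : (forall z, continuous u z) -> continuous (forcing n p a u) z.
Proof.
  intros H. apply (continuous_minus (V := R_NormedModule)).
  - apply (continuous_mult (K := R_AbsRing)); [apply continuous_const|now apply intercept_continuous].
  - apply (continuous_mult (K := R_AbsRing)); [apply continuous_const|].
    apply (continuous_mult (K := R_AbsRing)); [apply H|].
    apply (continuous_comp (fun s => s * u s) trunc_tan_excess).
    + now apply angle_continuous.
    + apply trunc_tan_excess_continuous.
Qed.

Lemma picard_continuous n p a u z : (forall z, continuous u z) -> continuous (picard n p a u) z.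
Proof.
  intros H. apply (average_continuous n _ (Rabs z + 1)); [|lra].
  intros. now apply forcing_continuous.
Qed.

Lemma slope_difference L u v d z :
  (forall z, Rabs (u z - v z) <= d * weight L z) ->
  Rabs (trunc_tan (z * u z) - trunc_tan (z * v z)) <= 2 * Rabs z * (d * weight L z).
Proof.
  intros H. eapply Rle_trans; [apply trunc_tan_abs_minus|].
  rewrite <- Rmult_minus_distr_l, Rabs_mult. specialize (H z). pose proof (Rabs_pos z). nra.
Qed.

(** The slopes differ by at most [2 s d exp (L s ^ 2)], which is the
    derivative of [d exp (L s ^ 2) / L]. *)
Lemma height_difference L a b u v d z :
  0 < L -> 0 <= d ->
  (forall z, continuous u z) -> (forall z, continuous v z) ->
  (forall z, Rabs (u z - v z) <= d * weight L z) ->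
  Rabs (height a u z - height b v z) <= Rabs (a - b) + d / L * weight L z.
Proof.
  intros HL Hd Hu Hv H.
  set (f := fun s => trunc_tan (s * u s) - trunc_tan (s * v s)).
  assert (Hf : forall s, continuous f s).
  { intros s. apply (continuous_minus (V := R_NormedModule)); now apply slope_continuous. }
  assert (E : height a u z - height b v z = (a - b) + z ^ 1 * average 0 f z).
  { rewrite average_integral by auto. unfold height.
    rewrite (RInt_ext (fun s => s ^ 0 * f s) (fun s => minus (trunc_tan (s * u s)) (trunc_tan (s * v s)))).
    - rewrite (RInt_minus (V := R_CompleteNormedModule) (fun s => trunc_tan (s * u s)) (fun s => trunc_tan (s * v s))).
      + unfold minus, plus, opp; simpl. ring.
      + apply (ex_RInt_continuous (V := R_CompleteNormedModule)). intros; now apply slope_continuous.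
      + apply (ex_RInt_continuous (V := R_CompleteNormedModule)). intros; now apply slope_continuous.
    - intros s _. unfold f, minus, plus, opp; simpl. ring. }
  rewrite E. eapply Rle_trans; [apply Rabs_triang|]. apply Rplus_le_compat_l.
  rewrite Rabs_mult, pow_1.
  set (g := fun s => 2 * d * (Rabs s * weight L s)).
  assert (Hg : forall s, continuous g s).
  { intros s. apply (continuous_mult (K := R_AbsRing)); [apply continuous_const|].
    apply (continuous_mult (K := R_AbsRing)); [apply continuous_Rabs|apply weight_continuous]. }
  assert (Ha : Rabs (average 0 f z) <= average 0 g z).
  { apply average_le; auto. intros x _. unfold f, g.
    eapply Rle_trans; [apply slope_difference; exact H|]. lra. }
  apply Rle_trans with (Rabs z * average 0 g z).
  { apply Rmult_le_compat_l; [apply Rabs_pos|exact Ha]. }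
  assert (HI : is_RInt (fun t => d * (2 * t * z ^ 2) * weight L (t * z)) 0 1
                (minus (d / L * exp (L * (1 * z) ^ 2)) (d / L * exp (L * (0 * z) ^ 2)))).
  { apply (is_RInt_derive (V := R_CompleteNormedModule) (fun t => d / L * exp (L * (t * z) ^ 2))).
    - intros t _. unfold weight. auto_derive; auto. simpl; field; lra.
    - intros t _. apply (ex_derive_continuous (V := R_NormedModule)). unfold weight.
      auto_derive. exact I. }
  assert (E2 : Rabs z * average 0 g z = RInt (fun t => d * (2 * t * z ^ 2) * weight L (t * z)) 0 1).
  { unfold average.
    change (Rabs z * RInt (fun t => t ^ 0 * g (t * z)) 0 1) with
      (scal (Rabs z) (RInt (fun t => t ^ 0 * g (t * z)) 0 1)).
    rewrite <- (RInt_scal (V := R_CompleteNormedModule)) by (apply average_ex; auto).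
    apply RInt_ext. intros t Ht. rewrite Rmin_left, Rmax_right in Ht by lra.
    unfold g, scal; simpl; unfold mult; simpl. rewrite Rabs_mult, (Rabs_right t) by lra.
    pose proof (pow2_abs z) as Hz. simpl in Hz. rewrite <- Hz. ring. }
  rewrite E2, (is_RInt_unique _ _ _ _ HI). unfold minus, plus, opp; simpl.
  rewrite Rmult_1_l, !Rmult_0_l, Rmult_0_r, exp_0.
  replace (exp (L * (z * (z * 1)))) with (weight L z) by reflexivity.
  assert (0 <= d / L) by (apply Rdiv_le_0_compat; lra). lra.
Qed.

Lemma intercept_difference L a b u v d z :
  0 < L -> 0 <= d ->
  (forall z, continuous u z) -> (forall z, continuous v z) ->
  (forall z, Rabs (u z - v z) <= d * weight L z) ->
  Rabs (intercept a u z - intercept b v z)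
    <= Rabs (a - b) + d * (1 / L + 2 * z ^ 2) * weight L z.
Proof.
  intros HL Hd Hu Hv H. unfold intercept.
  replace (height a u z - z * trunc_tan (z * u z) - (height b v z - z * trunc_tan (z * v z))) with
    ((height a u z - height b v z) + - (z * (trunc_tan (z * u z) - trunc_tan (z * v z)))) by ring.
  eapply Rle_trans; [apply Rabs_triang|]. rewrite Rabs_Ropp, Rabs_mult.
  pose proof (height_difference L a b u v d z HL Hd Hu Hv H) as H1.
  pose proof (slope_difference L u v d z H) as H2.
  assert (H3 : Rabs z * Rabs (trunc_tan (z * u z) - trunc_tan (z * v z)) <= 2 * z ^ 2 * (d * weight L z)).
  { rewrite <- (pow2_abs z). pose proof (Rabs_pos z). nra. }
  replace (d * (1 / L + 2 * z ^ 2) * weight L z) with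
    (d / L * weight L z + 2 * z ^ 2 * (d * weight L z)) by (field; lra).
  lra.
Qed.

Lemma intercept_bound L b v e x :
  0 < L -> 0 <= e -> (forall z, continuous v z) ->
  (forall z, Rabs (v z) <= e * weight L z) ->
  Rabs (intercept b v x) <= (Rabs b + e * (1 / L + 2 * x ^ 2)) * weight L x.
Proof.
  intros HL He Hv Hve.
  pose proof (intercept_difference L b 0 v (fun _ => 0) e x HL He Hv) as K.
  assert (E0 : intercept 0 (fun _ => 0) x = 0).
  { unfold intercept, height. rewrite Rmult_0_r, trunc_tan_0.
    rewrite (RInt_ext _ (fun _ => 0)).
    - rewrite RInt_const. unfold scal; simpl; unfold mult; simpl. ring.
    - intros s _. now rewrite Rmult_0_r, trunc_tan_0. }
  rewrite (Rminus_0_r b) in K. pose proof (weight_ge_1 L x ltac:(lra)) as Hw.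
  pose proof (Rabs_pos b).
  apply Rle_trans with (Rabs b + e * (1 / L + 2 * x ^ 2) * weight L x); [|nra].
  rewrite <- (Rminus_0_r (intercept b v x)), <- E0.
  apply K; [intros; apply continuous_const|]. intros y. now rewrite Rminus_0_r.
Qed.

(** The difference of the forcing terms splits in three: the intercepts at the
    same [p], the change of [p], and the excess. The middle one enters through the bounds
    [g] and [h], so that the estimate covers both the contraction property, where they
    vanish, and the dependence on the parameters. *)
Lemma picard_difference n L p p' a b u v d g h z :
  0 < L -> 0 <= d -> 0 <= g -> 0 <= h -> 0 <= p ->
  (forall z, continuous u z) -> (forall z, continuous v z) ->
  (forall z, Rabs (u z - v z) <= d * weight L z) ->
  (forall x, Rabs ((p - p') * intercept b v x) <= (g + h * (1 / L + 2 * x ^ 2)) * weight L x) ->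
  Rabs (picard n p a u z - picard n p' b v z)
    <= ((p * Rabs (a - b) + g + INR n * d) / INR (S n) + 2 * (p * d + h) / L) * weight L z.
Proof.
  intros HL Hd Hg Hh Hp Hu Hv H Hve. unfold picard.
  rewrite average_minus by (intros; now apply forcing_continuous).
  pose proof (pos_INR n) as Hn. pose proof (Rabs_pos (a - b)).
  assert (0 <= p * Rabs (a - b)) by (apply Rmult_le_pos; lra).
  assert (0 <= INR n * d) by (apply Rmult_le_pos; lra).
  assert (0 <= p * d) by (apply Rmult_le_pos; lra).
  apply average_weight_le; [exact HL|lra|lra| |].
  { intros x. apply (continuous_minus (V := R_NormedModule)); now apply forcing_continuous. }
  intros x. unfold forcing.
  pose proof (intercept_difference L a b u v d x HL Hd Hu Hv H) as I1.
  pose proof (Hve x) as I2.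
  pose proof (trunc_tan_excess_lipschitz x (u x) (v x)) as I3.
  pose proof (H x) as I4. pose proof (weight_ge_1 L x ltac:(lra)) as Hw.
  set (w := weight L x) in *. set (S := (1 / L + 2 * x ^ 2)) in *.
  replace (p * intercept a u x - INR n * (u x * trunc_tan_excess (x * u x))
           - (p' * intercept b v x - INR n * (v x * trunc_tan_excess (x * v x)))) with
    (p * (intercept a u x - intercept b v x) + (p - p') * intercept b v x
     + - (INR n * (u x * trunc_tan_excess (x * u x) - v x * trunc_tan_excess (x * v x)))) by ring.
  eapply Rle_trans; [apply Rabs_triang|]. rewrite Rabs_Ropp, (Rabs_mult (INR n)), (Rabs_right (INR n)) by lra.
  eapply Rle_trans; [apply Rplus_le_compat_r, Rabs_triang|].
  rewrite (Rabs_mult p), (Rabs_right p) by lra.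
  set (X := Rabs (intercept a u x - intercept b v x)) in *.
  set (Y := Rabs ((p - p') * intercept b v x)) in *.
  set (Z := Rabs (u x * trunc_tan_excess (x * u x) - v x * trunc_tan_excess (x * v x))) in *.
  assert (p * X <= p * (Rabs (a - b) + d * S * w)) by (apply Rmult_le_compat_l; lra).
  assert (INR n * Z <= INR n * (d * w)) by (apply Rmult_le_compat_l; lra).
  assert (p * Rabs (a - b) <= p * Rabs (a - b) * w) by nra.
  lra.
Qed.

(** The excess contributes [n / (n + 1)], and the weight is chosen so that the
    intercept contributes [1 / (2 (n + 1))]. *)
Definition contraction_rate (n : nat) : R := (2 * INR n + 1) / (2 * INR n + 2).

Lemma contraction_rate_range n : 0 <= contraction_rate n < 1.
Proof.
  pose proof (pos_INR n). unfold contraction_rate. split.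
  - apply Rdiv_le_0_compat; lra.
  - apply Rlt_div_l; lra.
Qed.

Lemma contraction_rate_gap n : 1 - contraction_rate n = / (2 * INR (S n)).
Proof. pose proof (pos_INR n). rewrite S_INR. unfold contraction_rate. field. lra. Qed.

Definition weight_rate (n : nat) (pm : R) : R := 4 * pm * INR (S n).

Lemma picard_contracts n pm p a :
  0 < pm -> 0 <= p <= pm -> contracts (picard n p a) (weight (weight_rate n pm)) (contraction_rate n).
Proof.
  intros Hpm Hp. split; [intros; now apply picard_continuous|].
  intros u v d Hu Hv Hd H z.
  pose proof (lt_0_INR (S n) ltac:(lia)) as Hn. pose proof (pos_INR n).
  assert (HL : 0 < weight_rate n pm) by (unfold weight_rate; nra).
  eapply Rle_trans.
  { apply (picard_difference n _ p p a a u v d 0 0 z HL Hd); try lra; auto.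
    intros x. rewrite Rminus_diag, Rmult_0_l, Rabs_R0. right. ring. }
  apply Rmult_le_compat_r; [left; apply weight_pos|].
  rewrite Rminus_diag, Rabs_R0, Rmult_0_r, !Rplus_0_r, Rplus_0_l.
  apply Rle_trans with (INR n * d / INR (S n) + d / (2 * INR (S n))).
  - apply Rplus_le_compat_l. unfold weight_rate. apply Rle_div_l; [nra|].
    replace (d / (2 * INR (S n)) * (4 * pm * INR (S n))) with (2 * (pm * d)) by (field; lra).
    nra.
  - right. unfold contraction_rate. rewrite S_INR. field. lra.
Qed.

Lemma picard_at_zero n p a z : 0 <= p -> 0 <= a -> Rabs (picard n p a (fun _ => 0) z) <= p * a.
Proof.
  intros Hp Ha. unfold picard.
  assert (E : forall x, forcing n p a (fun _ => 0) x = p * a).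
  { intros x. unfold forcing, intercept, height. rewrite Rmult_0_r, trunc_tan_0.
    rewrite (RInt_ext _ (fun _ => 0)).
    - rewrite RInt_const. unfold scal; simpl; unfold mult; simpl. ring.
    - intros s _. now rewrite Rmult_0_r, trunc_tan_0. }
  rewrite (average_ext n _ (fun _ => p * a)) by auto.
  replace (average n (fun _ => p * a) z) with (average n (fun _ => p * a) 0) by reflexivity.
  rewrite average_at_0. pose proof (lt_0_INR (S n) ltac:(lia)) as Hn.
  assert (1 <= INR (S n)) by (apply (le_INR 1); lia).
  assert (0 <= p * a) by nra.
  rewrite Rabs_right by (apply Rle_ge, Rdiv_le_0_compat; lra).
  apply Rle_div_l; nra.
Qed.

Lemma picard_even n p a u :
  (forall z, continuous u z) ->
  (forall z, u (- z) = u z) -> forall z, picard n p a u (- z) = picard n p a u z.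
Proof.
  intros Hc Hu z. apply average_even. intros x. unfold forcing, intercept.
  assert (E : height a u (- x) = height a u x).
  { unfold height. f_equal.
    rewrite RInt_reflect by (intros; now apply slope_continuous).
    rewrite <- (RInt_opp (V := R_CompleteNormedModule)).
    - apply RInt_ext. intros y _. unfold opp; simpl.
      rewrite Hu, Ropp_mult_distr_l_reverse, trunc_tan_odd. ring.
    - apply (ex_RInt_continuous (V := R_CompleteNormedModule)). intros y _.
      apply (continuous_comp Ropp (fun s => trunc_tan (s * u s))).
      + apply (continuous_opp (V := R_NormedModule) (fun y => y)), continuous_id.
      + now apply slope_continuous. }
  rewrite E, Hu, !Ropp_mult_distr_l_reverse, trunc_tan_odd, trunc_tan_excess_even. ring.
Qed.

(** * Trajectories issued from the axis *)

(** The trajectory with parameter [p] starting at height [a] with slope 0 is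
    [profile n p a], and [angle n p a] is its angle. *)
Definition angle_ratio (n : nat) (p a : R) : R -> R := fixpoint (picard n p a).
Definition profile (n : nat) (p a : R) : R -> R := height a (angle_ratio n p a).
Definition angle (n : nat) (p a z : R) : R := z * angle_ratio n p a z.

Lemma weight_locally_bounded L r : 0 <= L -> exists B, forall z, Rabs z < r -> weight L z <= B.
Proof.
  intros HL. exists (weight L r). intros z Hz. apply weight_le; [exact HL|].
  pose proof (Rle_abs r). lra.
Qed.

Lemma weight_rate_pos n pm : 0 < pm -> 0 < weight_rate n pm.
Proof. intros H. pose proof (lt_0_INR (S n) ltac:(lia)). unfold weight_rate. nra. Qed.

Lemma picard_start n pm p a : 0 < pm -> 0 <= p <= pm -> 0 <= a ->
  forall z, Rabs (picard n p a (fun _ => 0) z) <= p * a * weight (weight_rate n pm) z.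
Proof.
  intros Hpm Hp Ha z. pose proof (picard_at_zero n p a z ltac:(lra) Ha).
  pose proof (weight_rate_pos n pm Hpm). pose proof (weight_ge_1 (weight_rate n pm) z ltac:(lra)).
  assert (0 <= p * a) by nra. nra.
Qed.

Lemma angle_ratio_continuous n p a z : 0 < p -> 0 <= a -> continuous (angle_ratio n p a) z.
Proof.
  intros Hp Ha. pose proof (weight_rate_pos n p Hp).
  apply (fixpoint_continuous (picard n p a) (weight (weight_rate n p)) (contraction_rate n) (p * a)).
  - apply contraction_rate_range.
  - intros; left; apply weight_pos.
  - nra.
  - apply picard_contracts; lra.
  - apply picard_start; lra.
  - intros r. apply weight_locally_bounded. lra.
Qed.

Lemma angle_ratio_fixed n p a z : 0 < p -> 0 <= a -> picard n p a (angle_ratio n p a) z = angle_ratio n p a z.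
Proof.
  intros Hp Ha. pose proof (weight_rate_pos n p Hp).
  apply (fixpoint_fixed (picard n p a) (weight (weight_rate n p)) (contraction_rate n) (p * a)).
  - apply contraction_rate_range.
  - intros; left; apply weight_pos.
  - nra.
  - apply picard_contracts; lra.
  - apply picard_start; lra.
  - intros r. apply weight_locally_bounded. lra.
Qed.

Lemma angle_ratio_even n p a z : 0 < p -> angle_ratio n p a (- z) = angle_ratio n p a z.
Proof.
  intros Hp. apply (fixpoint_even (picard n p a) (weight (weight_rate n p)) (contraction_rate n)).
  - apply picard_contracts; lra.
  - intros u Hc He. now apply picard_even.
Qed.

Lemma angle_ratio_bound n pm p a z : 0 < pm -> 0 <= p <= pm -> 0 <= a ->
  Rabs (angle_ratio n p a z) <= p * a / (1 - contraction_rate n) * weight (weight_rate n pm) z.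
Proof.
  intros Hpm Hp Ha. pose proof (weight_rate_pos n pm Hpm).
  apply (fixpoint_bound (picard n p a) (weight (weight_rate n pm)) (contraction_rate n) (p * a)).
  - apply contraction_rate_range.
  - intros; left; apply weight_pos.
  - nra.
  - apply picard_contracts; lra.
  - apply picard_start; lra.
Qed.

Lemma profile_0 n p a : profile n p a 0 = a.
Proof. apply height_0. Qed.

Lemma profile_derive n p a z : 0 < p -> 0 <= a ->
  is_derive (profile n p a) z (trunc_tan (angle n p a z)).
Proof. intros Hp Ha. apply height_derive. intros; now apply angle_ratio_continuous. Qed.

Lemma angle_derive n p a z : 0 < p -> 0 <= a ->
  is_derive (angle n p a) z (forcing n p a (angle_ratio n p a) z - INR n * angle_ratio n p a z).
Proof.
  intros Hp Ha.
  assert (Hc : forall z, continuous (angle_ratio n p a) z) by (intros; now apply angle_ratio_continuous).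
  apply (is_derive_ext (fun y => y * average n (forcing n p a (angle_ratio n p a)) y)).
  - intros t. unfold angle. rewrite <- (angle_ratio_fixed n p a t) by assumption. reflexivity.
  - eapply derive_eq.
    + apply (average_moment_derive n _ (Rabs z + 1)); [|lra].
      intros. now apply forcing_continuous.
    + change (average n (forcing n p a (angle_ratio n p a)) z) with (picard n p a (angle_ratio n p a) z).
      now rewrite angle_ratio_fixed.
Qed.

Lemma angle_derive_nonzero n p a z : 0 < p -> 0 <= a -> z <> 0 ->
  is_derive (angle n p a) z
    (p * (profile n p a z - z * trunc_tan (angle n p a z)) - INR n / z * trunc_tan (angle n p a z)).
Proof.
  intros Hp Ha Hz. eapply derive_eq; [now apply angle_derive|].
  unfold forcing, intercept, profile, angle. set (u := angle_ratio n p a z).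
  pose proof (trunc_tan_excess_spec (z * u)) as E.
  replace (trunc_tan (z * u)) with (z * u * trunc_tan_excess (z * u) + z * u) by lra.
  field. exact Hz.
Qed.

Lemma profile_comparison n p a : 0 < p -> 0 <= a ->
  comparison (INR n) p (fun _ => 0) (profile n p a) (fun z => trunc_tan (angle n p a z)) (angle n p a).
Proof.
  intros Hp Ha. constructor.
  - intros z. eapply derive_continuous, profile_derive; assumption.
  - intros z. eapply derive_continuous, angle_derive; assumption.
  - intros z _. now apply profile_derive.
  - intros z Hz. rewrite Rplus_0_r. apply angle_derive_nonzero; lra.
  - unfold angle. ring.
  - intros z Hz. rewrite <- trunc_tan_0. now apply trunc_tan_increasing.
  - intros z ->. apply trunc_tan_0.
  - intros z Hz. rewrite <- trunc_tan_0. now apply trunc_tan_increasing.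
Qed.

Lemma profile_slope_continuous n p a z : 0 < p -> 0 <= a ->
  continuous (fun z => trunc_tan (angle n p a z)) z.
Proof.
  intros Hp Ha. apply (continuous_comp (angle n p a) trunc_tan); [|apply trunc_tan_continuous].
  eapply derive_continuous, angle_derive; assumption.
Qed.

(** The difference of two solutions with different [p] is measured with [p1] as
    coefficient; what remains is [(p2 - p1)] times the intercept of the second one. *)
Lemma difference_comparison n r D1 D2 t1 t2 p1 p2 :
  comparison n p1 (fun _ => 0) D1 (fun z => trunc_tan (t1 z)) t1 ->
  comparison n p2 (fun _ => 0) D2 (fun z => trunc_tan (t2 z)) t2 ->
  (forall z, r z = (p2 - p1) * (D2 z - z * trunc_tan (t2 z))) ->
  comparison n p1 r (fun z => D2 z - D1 z) (fun z => trunc_tan (t2 z) - trunc_tan (t1 z))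
    (fun z => t2 z - t1 z).
Proof.
  intros H1 H2 Hr. constructor.
  - intros z. apply (continuous_minus (V := R_NormedModule));
      [exact (cmp_D_cont _ _ _ _ _ _ H2 z)|exact (cmp_D_cont _ _ _ _ _ _ H1 z)].
  - intros z. apply (continuous_minus (V := R_NormedModule));
      [exact (cmp_e_cont _ _ _ _ _ _ H2 z)|exact (cmp_e_cont _ _ _ _ _ _ H1 z)].
  - intros z Hz. apply (is_derive_minus (V := R_NormedModule));
      [exact (cmp_D_derive _ _ _ _ _ _ H2 z Hz)|exact (cmp_D_derive _ _ _ _ _ _ H1 z Hz)].
  - intros z Hz. eapply derive_eq.
    + apply (is_derive_minus (V := R_NormedModule));
        [exact (cmp_e_derive _ _ _ _ _ _ H2 z Hz)|exact (cmp_e_derive _ _ _ _ _ _ H1 z Hz)].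
    + rewrite Hr. unfold minus, plus, opp; simpl. field. lra.
  - rewrite (cmp_e0 _ _ _ _ _ _ H1), (cmp_e0 _ _ _ _ _ _ H2). ring.
  - intros z Hz. assert (t1 z < t2 z) as K by lra. apply trunc_tan_increasing in K. lra.
  - intros z Hz. replace (t2 z) with (t1 z) by lra. ring.
  - intros z Hz. assert (t2 z < t1 z) as K by lra. apply trunc_tan_increasing in K. lra.
Qed.

(** Two trajectories with the same [p] move apart, by
    [comparison_increasing]. Hence the starting height that leads to a given end height
    is a Lipschitz function of the data. *)
Lemma profile_spread n p a b : 0 < p -> 0 <= a <= b ->
  b - a <= profile n p b 1 - profile n p a 1.
Proof.
  intros Hp [Ha [Hb|<-]]; [|lra].
  pose proof (difference_comparison (INR n) (fun _ => 0) _ _ _ _ p p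
    (profile_comparison n p a Hp Ha) (profile_comparison n p b Hp ltac:(lra))
    ltac:(intros; cbv beta; ring)) as H.
  pose proof (comparison_increasing (INR n) p (fun _ => 0) _ _ _ Hp (pos_INR n)
    ltac:(intros; lra) H) as K.
  cbv beta in K. rewrite !profile_0 in K. specialize (K ltac:(lra) 0 1 ltac:(lra) ltac:(lra)). rewrite !profile_0 in K. exact K.
Qed.

(** Both trajectories are fixed points of Picard operators that differ by
    [O(|a - b| + |p - p'|)] in the weighted norm, so [contraction_stability] applies; the
    same weight is used for all [p <= pm]. *)
Lemma parameters_lipschitz n pm : 0 < pm ->
  exists K, 0 <= K /\
  forall p p' a b, 0 < p <= pm -> 0 < p' <= pm -> 0 <= a <= 1 -> 0 <= b <= 1 ->
    Rabs (profile n p a 1 - profile n p' b 1) <= K * (Rabs (a - b) + Rabs (p - p')) /\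
    Rabs (angle n p a 1 - angle n p' b 1) <= K * (Rabs (a - b) + Rabs (p - p')).
Proof.
  intros Hpm. set (L := weight_rate n pm). pose proof (weight_rate_pos n pm Hpm) as HL. fold L in HL.
  pose proof (lt_0_INR (S n) ltac:(lia)) as Hn. pose proof (pos_INR n) as Hn0.
  set (N := INR (S n)) in *.
  assert (EN : INR n = N - 1) by (unfold N; rewrite S_INR; ring).
  assert (HN1 : 1 <= N) by lra.
  set (e := pm * (2 * N)).
  set (c := pm / N + 1 / N + 2 * e / L).
  assert (He : 0 <= e) by (unfold e; nra).
  assert (Hc : 0 <= c).
  { unfold c. assert (0 <= pm / N) by (apply Rdiv_le_0_compat; lra).
    assert (0 <= 1 / N) by (apply Rdiv_le_0_compat; lra).
    assert (0 <= 2 * e / L) by (apply Rdiv_le_0_compat; lra). lra. }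
  set (W1 := weight L 1). assert (HW1 : 1 <= W1) by (apply weight_ge_1; lra).
  set (K := c * (2 * N)). assert (HK : 0 <= K) by (unfold K; nra).
  assert (HKL : 0 <= K / L) by (apply Rdiv_le_0_compat; lra).
  assert (Main : forall p p' a b, 0 < p <= pm -> 0 < p' <= pm -> 0 <= a <= 1 -> 0 <= b <= 1 ->
     forall z, Rabs (angle_ratio n p a z - angle_ratio n p' b z)
               <= K * (Rabs (a - b) + Rabs (p - p')) * weight L z).
  { intros p p' a b Hp Hp' Ha Hb.
    set (s := Rabs (a - b) + Rabs (p - p')).
    assert (Hbound : forall p a, 0 < p <= pm -> 0 <= a <= 1 ->
              forall z, Rabs (angle_ratio n p a z) <= e * weight L z).
    { intros p0 a0 Hp0 Ha0 z.
      eapply Rle_trans; [apply (angle_ratio_bound n pm); lra|].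
      apply Rmult_le_compat_r; [left; apply weight_pos|].
      unfold Rdiv. rewrite contraction_rate_gap, Rinv_inv. fold N. unfold e.
      apply Rmult_le_compat_r; nra. }
    assert (Hs : 0 <= s).
    { unfold s. pose proof (Rabs_pos (a - b)); pose proof (Rabs_pos (p - p')). lra. }
    assert (Hst : forall z, Rabs (angle_ratio n p a z - angle_ratio n p' b z) <= c * s / (1 - contraction_rate n) * weight L z).
    { apply (contraction_stability (picard n p a) (weight L) _ _ (contraction_rate n) (2 * e)).
      - apply contraction_rate_range.
      - intros; left; apply weight_pos.
      - lra.
      - nra.
      - intros d Hd Hclose z.
        rewrite <- (angle_ratio_fixed n p a), <- (angle_ratio_fixed n p' b) by lra.
        eapply Rle_trans.
        + apply (picard_difference n L p p' a b _ _ d (Rabs (p - p')) (Rabs (p - p') * e));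
            try lra; try assumption.
          * apply Rabs_pos.
          * apply Rmult_le_pos; [apply Rabs_pos|exact He].
          * intros; apply angle_ratio_continuous; lra.
          * intros; apply angle_ratio_continuous; lra.
          * intros x. rewrite Rabs_mult.
            pose proof (intercept_bound L b (angle_ratio n p' b) e x HL He
              ltac:(intros; apply angle_ratio_continuous; lra) (Hbound p' b Hp' Hb)) as Hi.
            rewrite (Rabs_right b) in Hi by lra.
            pose proof (weight_pos L x). pose proof (Rabs_pos (p - p')).
            apply Rle_trans with (Rabs (p - p') * ((1 + e * (1 / L + 2 * x ^ 2)) * weight L x)).
            -- apply Rmult_le_compat_l; [lra|]. eapply Rle_trans; [exact Hi|].
               apply Rmult_le_compat_r; lra.
            -- right. ring.
        + apply Rmult_le_compat_r; [left; apply weight_pos|]. fold N.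
          pose proof (Rabs_pos (a - b)). pose proof (Rabs_pos (p - p')).
          replace ((p * Rabs (a - b) + Rabs (p - p') + INR n * d) / N
                   + 2 * (p * d + Rabs (p - p') * e) / L) with
            (p / N * Rabs (a - b) + (1 / N + 2 * e / L) * Rabs (p - p')
              + (INR n * d / N + 2 * (p * d) / L)) by (field; lra).
          assert (Hr : INR n * d / N + 2 * (p * d) / L <= contraction_rate n * d).
          { apply Rle_trans with (INR n * d / N + d / (2 * N)).
            - apply Rplus_le_compat_l. apply Rle_div_l; [lra|].
              unfold L, weight_rate. fold N.
              replace (d / (2 * N) * (4 * pm * N)) with (2 * (pm * d)) by (field; lra). nra.
            - right. unfold contraction_rate. rewrite EN. field. lra. }
          assert (p / N * Rabs (a - b) <= c * Rabs (a - b)).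
          { apply Rmult_le_compat_r; [lra|]. unfold c.
            assert (p / N <= pm / N) by (apply Rmult_le_compat_r; [left; apply Rinv_0_lt_compat; lra|lra]).
            assert (0 <= 1 / N) by (apply Rdiv_le_0_compat; lra).
            assert (0 <= 2 * e / L) by (apply Rdiv_le_0_compat; lra). lra. }
          assert ((1 / N + 2 * e / L) * Rabs (p - p') <= c * Rabs (p - p')).
          { apply Rmult_le_compat_r; [lra|]. unfold c.
            assert (0 <= pm / N) by (apply Rdiv_le_0_compat; lra). lra. }
          unfold s. lra.
      - intros z. pose proof (Hbound p a Hp Ha z). pose proof (Hbound p' b Hp' Hb z).
        unfold Rminus. eapply Rle_trans; [apply Rabs_triang|]. rewrite Rabs_Ropp. lra. }
    intros z. eapply Rle_trans; [apply Hst|]. right. unfold Rdiv.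
    rewrite contraction_rate_gap, Rinv_inv. fold N. unfold K. ring. }
  exists (1 + K * W1 + K / L * W1). split; [nra|].
  intros p p' a b Hp Hp' Ha Hb. set (s := Rabs (a - b) + Rabs (p - p')).
  assert (Hs : Rabs (a - b) <= s) by (unfold s; pose proof (Rabs_pos (p - p')); lra).
  pose proof (Rabs_pos (a - b)).
  specialize (Main p p' a b Hp Hp' Ha Hb). fold s in Main. split.
  - eapply Rle_trans.
    + apply (height_difference L a b _ _ (K * s)); try lra; try assumption; try nra.
      * intros; apply angle_ratio_continuous; lra.
      * intros; apply angle_ratio_continuous; lra.
    + fold W1. replace (K * s / L * W1) with (K / L * W1 * s) by (field; lra).
      assert (0 <= K * W1 * s) by (apply Rmult_le_pos; nra). lra.
  - unfold angle. rewrite !Rmult_1_l. eapply Rle_trans; [apply Main|]. fold W1.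
    assert (0 <= K / L * W1 * s) by (apply Rmult_le_pos; nra). nra.
Qed.

(** * Shooting to the corner *)

Lemma profile_null n p : 0 < p -> profile n p 0 1 = 0.
Proof.
  intros Hp. unfold profile, height. rewrite Rplus_0_l.
  rewrite (RInt_ext _ (fun _ => 0)).
  - rewrite RInt_const. unfold scal; simpl; unfold mult; simpl. ring.
  - intros s _.
    pose proof (angle_ratio_bound n p p 0 s Hp ltac:(lra) ltac:(lra)) as H.
    rewrite Rmult_0_r in H. unfold Rdiv in H. rewrite !Rmult_0_l in H.
    destruct (Req_dec (angle_ratio n p 0 s) 0) as [->|Hne].
    + now rewrite Rmult_0_r, trunc_tan_0.
    + apply Rabs_pos_lt in Hne. lra.
Qed.

(** The intermediate value theorem in the starting height: from height 0 the
    trajectory stays at 0, from height 1 it ends at height at least 1. *)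
Lemma reach_one n p : 0 < p -> exists a, 0 < a <= 1 /\ profile n p a 1 = 1.
Proof.
  intros Hp. destruct (parameters_lipschitz n p Hp) as [K [HK HL]].
  destruct (lipschitz_ivt (fun a => profile n p a 1) 0 1 K 1) as [a [Ha E]]; [lra|exact HK| | |].
  - intros x y Hx Hy. destruct (HL p p x y) as [H _]; try lra.
    rewrite (Rminus_diag p), Rabs_R0, Rplus_0_r in H. exact H.
  - split; [rewrite profile_null; lra|].
    pose proof (profile_spread n p 0 1 Hp ltac:(lra)) as H. rewrite profile_null in H; lra.
  - exists a. split; [|exact E]. split; [|lra].
    destruct (Req_dec a 0) as [->|]; [|lra]. rewrite profile_null in E; lra.
Qed.

Lemma angle_positive n p a z : 0 < p -> 0 < a -> 0 < z < 1 -> 0 < angle n p a z.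
Proof.
  intros Hp Ha. apply (comparison_positive _ _ _ _ _ _ Hp (pos_INR n)
    (fun _ _ => Rle_refl 0) (profile_comparison n p a Hp ltac:(lra))).
  rewrite profile_0. exact Ha.
Qed.

Lemma profile_increasing n p a x y : 0 < p -> 0 < a -> 0 <= x <= y -> y <= 1 ->
  profile n p a x <= profile n p a y.
Proof.
  intros Hp Ha. apply (comparison_increasing _ _ _ _ _ _ Hp (pos_INR n)
    (fun _ _ => Rle_refl 0) (profile_comparison n p a Hp ltac:(lra))).
  rewrite profile_0. exact Ha.
Qed.

Lemma profile_curvature n p a z : 0 < p -> 0 < a -> 0 < z <= 1 ->
  0 < p * (profile n p a z - z * trunc_tan (angle n p a z)) - INR n / z * trunc_tan (angle n p a z).
Proof.
  intros Hp Ha Hz.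
  refine (curvature_positive (INR n) p 2 _ _ _ (fun z => trunc_tan_slope (angle n p a z)) Hp (pos_INR n)
           (profile_comparison n p a Hp ltac:(lra)) _ _ _ _ z Hz).
  - rewrite profile_0. exact Ha.
  - intros y. apply profile_slope_continuous; lra.
  - intros y Hy. eapply derive_eq.
    + apply (is_derive_comp trunc_tan (angle n p a)); [apply trunc_tan_derive|].
      apply angle_derive_nonzero; lra.
    + unfold scal; simpl; unfold mult; simpl. ring.
  - intros y _. pose proof (trunc_tan_slope_range (angle n p a y)). lra.
Qed.

Lemma angle_increasing n p a x y : 0 < p -> 0 < a -> 0 <= x < y -> y <= 1 ->
  angle n p a x < angle n p a y.
Proof.
  intros Hp Ha Hx Hy.
  apply (derive_pos_lt _ (fun z => p * (profile n p a z - z * trunc_tan (angle n p a z))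
                                   - INR n / z * trunc_tan (angle n p a z))); [lra| |].
  - intros z Hz. split; [apply angle_derive_nonzero; lra|apply profile_curvature; lra].
  - intros z _. apply (profile_comparison n p a); lra.
Qed.

(** By the mean value theorem the final angle is [theta' c <= p phi c <= p]. *)
Lemma small_p_shallow n p a : 0 < p -> 0 < a -> profile n p a 1 = 1 -> angle n p a 1 <= p.
Proof.
  intros Hp Ha H1. pose proof (profile_comparison n p a Hp ltac:(lra)) as H.
  destruct (mean_value (angle n p a) _ 0 1 ltac:(lra) (cmp_e_derive _ _ _ _ _ _ H))
    as [x [Hx E]].
  { intros z _. apply H. }
  rewrite (cmp_e0 _ _ _ _ _ _ H) in E.
  pose proof (angle_positive n p a x Hp Ha Hx) as Hpos. apply trunc_tan_increasing in Hpos.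
  rewrite trunc_tan_0 in Hpos.
  pose proof (profile_increasing n p a x 1 Hp Ha ltac:(lra) ltac:(lra)) as Hinc.
  set (w := trunc_tan (angle n p a x)) in *.
  assert (0 <= INR n / x * w).
  { apply Rmult_le_pos; [apply Rdiv_le_0_compat; [apply pos_INR|lra]|lra]. }
  assert (0 <= x * w) by nra. nra.
Qed.

(** If the final slope were below [k], convexity would keep the slope below
    [k] and the intercept above [1 - k]; the angle would then gain at least [atan k] on
    [1/2, 1]. *)
Lemma large_p_steep n p a k : 0 < p -> 0 < a -> 0 < k < 1 ->
  2 * atan k + 2 * k * INR n <= p * (1 - k) ->
  profile n p a 1 = 1 -> atan k <= angle n p a 1.
Proof.
  intros Hp Ha Hk Hpk H1. apply Rnot_lt_le. intros Hlt.
  pose proof (profile_comparison n p a Hp ltac:(lra)) as H.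
  assert (Hw : forall z, 0 < z <= 1 -> trunc_tan (angle n p a z) < k).
  { intros z Hz. rewrite <- (trunc_tan_atan k) by (rewrite Rabs_right; lra).
    apply trunc_tan_increasing. eapply Rle_lt_trans; [|exact Hlt].
    destruct (Req_dec z 1) as [->|]; [lra|]. left. apply angle_increasing; lra. }
  (* away from 0 the factor [1 / z] is at most 2 *)
  destruct (mean_value (angle n p a)
    (fun z => p * (profile n p a z - z * trunc_tan (angle n p a z)) - INR n / z * trunc_tan (angle n p a z))
    (/ 2) 1 ltac:(lra)) as [x [Hx E]].
  { intros z Hz. apply angle_derive_nonzero; lra. }
  { intros z _. apply H. }
  cbv beta in E.
  destruct (mean_value (profile n p a) _ x 1 ltac:(lra)
     (fun z Hz => cmp_D_derive _ _ _ _ _ _ H z ltac:(lra))) as [y [Hy E2]].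
  { intros z _. apply H. }
  cbv beta in E2. pose proof (Hw x ltac:(lra)) as Hwx. pose proof (Hw y ltac:(lra)) as Hwy.
  pose proof (angle_positive n p a x Hp Ha ltac:(lra)) as Hpos.
  apply trunc_tan_increasing in Hpos. rewrite trunc_tan_0 in Hpos.
  pose proof (angle_positive n p a (/ 2) Hp Ha ltac:(lra)) as Hhalf.
  set (w := trunc_tan (angle n p a x)) in *.
  assert (Hq : 1 - k <= profile n p a x - x * w) by nra.
  assert (Hn : INR n / x * w <= 2 * k * INR n).
  { replace (INR n / x * w) with (INR n * (/ x * w)) by (unfold Rdiv; ring).
    replace (2 * k * INR n) with (INR n * (2 * k)) by ring.
    apply Rmult_le_compat_l; [apply pos_INR|].
    apply Rmult_le_compat; try lra.
    - left. apply Rinv_0_lt_compat. lra.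
    - replace 2 with (/ / 2) by field. apply Rinv_le_contravar; lra. }
  assert (p * (1 - k) <= p * (profile n p a x - x * w)) by (apply Rmult_le_compat_l; lra).
  nra.
Qed.

(** For each [p] the starting height is adjusted so that the end height is 1; by
    [profile_spread] and [parameters_lipschitz] it is a Lipschitz function of [p]. The
    final angle is then continuous in [p], at most [atan k] for [p = atan k], and at least
    [atan k] for [p = pm]. *)
Lemma shooting n k pm : 0 < k < 1 -> atan k <= pm ->
  2 * atan k + 2 * k * INR n <= pm * (1 - k) ->
  exists p a, atan k <= p <= pm /\ 0 < a <= 1 /\
    profile n p a 1 = 1 /\ angle n p a 1 = atan k.
Proof.
  intros Hk Hpm Hpk.
  assert (Hk0 : 0 < atan k) by (rewrite <- atan_0; apply atan_increasing; lra).
  destruct (parameters_lipschitz n pm ltac:(lra)) as [K [HK HL]].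
  assert (Ha : forall p, exists a, 0 < p -> 0 < a <= 1 /\ profile n p a 1 = 1).
  { intros p. destruct (Rlt_dec 0 p) as [Hp|Hp].
    - destruct (reach_one n p Hp) as [a Ha]. now exists a.
    - exists 0. intros; lra. }
  destruct (functional_choice _ Ha) as [f Hf].
  destruct (lipschitz_ivt (fun p => angle n p (f p) 1) (atan k) pm (K * (K + 1)) (atan k))
    as [p [Hp E]]; [exact Hpm|nra| | |].
  - intros p p' Hp Hp'.
    destruct (Hf p ltac:(lra)) as [Hfp Ep]. destruct (Hf p' ltac:(lra)) as [Hfp' Ep'].
    assert (Hff : Rabs (f p - f p') <= K * Rabs (p - p')).
    { destruct (HL p p' (f p') (f p')) as [Hd _]; try lra.
      rewrite (Rminus_diag (f p')), Rabs_R0, Rplus_0_l, Ep' in Hd.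
      eapply Rle_trans; [|exact Hd].
      destruct (Rle_dec (f p) (f p')) as [Hle|Hle].
      - pose proof (profile_spread n p (f p) (f p') ltac:(lra) ltac:(lra)) as Hs. rewrite Ep in Hs.
        rewrite (Rabs_left1 (f p - f p')), (Rabs_right (profile n p (f p') 1 - 1)); lra.
      - pose proof (profile_spread n p (f p') (f p) ltac:(lra) ltac:(lra)) as Hs. rewrite Ep in Hs.
        rewrite (Rabs_right (f p - f p')), (Rabs_left1 (profile n p (f p') 1 - 1)); lra. }
    destruct (HL p p' (f p) (f p')) as [_ Hd]; try lra.
    eapply Rle_trans; [exact Hd|].
    replace (K * (K + 1) * Rabs (p - p')) with (K * (K * Rabs (p - p') + Rabs (p - p'))) by ring.
    apply Rmult_le_compat_l; lra.
  - destruct (Hf (atan k) Hk0) as [Hf1 E1]. destruct (Hf pm ltac:(lra)) as [Hf2 E2]. split.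
    + apply small_p_shallow; lra.
    + apply large_p_steep; lra.
  - destruct (Hf p ltac:(lra)) as [Hfp Ep]. now exists p, (f p).
Qed.

(** * Smoothness up to the axis *)

(** Class C^k on the symmetric interval of radius [r]. Working on an open
    interval beyond 1 makes all derivatives two-sided. *)
Fixpoint Ck_on (r : R) (k : nat) (f : R -> R) : Prop :=
  match k with
  | O => forall x, Rabs x < r -> continuous f x
  | S k => exists df, (forall x, Rabs x < r -> is_derive f x (df x)) /\ Ck_on r k df
  end.

Lemma Ck_continuous r k f : Ck_on r k f ->
  forall x, Rabs x < r -> continuous f x.
Proof.
  destruct k as [|k]; [auto|]. intros [df [H _]] x Hx. eapply derive_continuous, H, Hx.
Qed.

Lemma Ck_ext r k f g : (forall x, Rabs x < r -> f x = g x) ->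
  Ck_on r k f -> Ck_on r k g.
Proof.
  intros E. destruct k as [|k]; simpl.
  - intros H x Hx. apply continuous_ext_loc with f; [|now apply H].
    now apply filter_imp with (2 := locally_abs_lt r x Hx).
  - intros [df [H1 H2]]. exists df. split; [|exact H2]. intros x Hx.
    apply is_derive_ext_loc with f; [|now apply H1].
    now apply filter_imp with (2 := locally_abs_lt r x Hx).
Qed.

Lemma Ck_weaken r k f : Ck_on r (S k) f -> Ck_on r k f.
Proof.
  revert f. induction k as [|k IH]; intros f H.
  - intros x. now apply (Ck_continuous r 1).
  - destruct H as [df [H1 H2]]. exists df. split; [exact H1|]. now apply IH.
Qed.

Lemma Ck_const r k c : Ck_on r k (fun _ => c).
Proof.
  revert c. induction k as [|k IH]; intros c.
  - intros x _. apply continuous_const.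
  - exists (fun _ => 0). split; [|apply IH]. intros x _.
    apply (is_derive_const (K := R_AbsRing) (V := R_NormedModule)).
Qed.

Lemma Ck_id r k : Ck_on r k (fun x => x).
Proof.
  destruct k as [|k].
  - intros x _. apply continuous_id.
  - exists (fun _ => 1). split; [|apply Ck_const]. intros x _.
    apply (is_derive_id (K := R_AbsRing)).
Qed.

Lemma Ck_plus r k f g : Ck_on r k f -> Ck_on r k g ->
  Ck_on r k (fun x => f x + g x).
Proof.
  revert f g. induction k as [|k IH]; intros f g Hf Hg.
  - intros x Hx. apply (continuous_plus (V := R_NormedModule)); auto.
  - destruct Hf as [df [F1 F2]], Hg as [dg [G1 G2]].
    exists (fun x => df x + dg x). split; [|now apply IH]. intros x Hx.
    apply (is_derive_plus (V := R_NormedModule)); auto.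
Qed.

Lemma Ck_mult r k f g : Ck_on r k f -> Ck_on r k g ->
  Ck_on r k (fun x => f x * g x).
Proof.
  revert f g. induction k as [|k IH]; intros f g Hf Hg.
  - intros x Hx. apply (continuous_mult (K := R_AbsRing)); auto.
  - pose proof (Ck_weaken _ _ _ Hf) as Hf'. pose proof (Ck_weaken _ _ _ Hg) as Hg'.
    destruct Hf as [df [F1 F2]], Hg as [dg [G1 G2]].
    exists (fun x => df x * g x + f x * dg x). split.
    + intros x Hx. apply (is_derive_mult f g x (df x) (dg x)); auto.
      intros n m. apply Rmult_comm.
    + apply Ck_plus; now apply IH.
Qed.

Lemma Ck_minus r k f g : Ck_on r k f -> Ck_on r k g ->
  Ck_on r k (fun x => f x - g x).
Proof.
  intros Hf Hg. apply Ck_ext with (fun x => f x + -1 * g x).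
  - intros x _. ring.
  - apply Ck_plus; [exact Hf|]. apply Ck_mult; [apply Ck_const|exact Hg].
Qed.

Lemma Ck_average r k n f : Ck_on r k f -> Ck_on r k (average n f).
Proof.
  revert n f. induction k as [|k IH]; intros n f H.
  - intros x Hx. now apply average_continuous with r.
  - destruct H as [df [H1 H2]]. exists (average (S n) df). split; [|now apply IH].
    apply average_derive; [exact H1|now apply (Ck_continuous r k)].
Qed.

Lemma Ck_Derive r k f : Ck_on r (S k) f -> Ck_on r k (Derive f).
Proof.
  intros [df [H1 H2]]. apply Ck_ext with df; [|exact H2].
  intros x Hx. symmetry. now apply is_derive_unique, H1.
Qed.

Lemma Ck_Derive_n r f : (forall k, Ck_on r k f) ->
  forall j x, Rabs x < r -> is_derive (Derive_n f j) x (Derive_n f (S j) x).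
Proof.
  intros H j x Hx.
  assert (K : forall k, Ck_on r k (Derive_n f j)).
  { induction j as [|j IH]; intros k; [apply H|]. apply Ck_Derive, IH. }
  destruct (K 1%nat) as [df [H1 _]]. apply Derive_correct. exists (df x). now apply H1.
Qed.

(** With [g = w / z] the equation for the slope is
    [z g' + (n + 1) g = radial_source], that is [g = average n radial_source]. *)
Definition radial_source (n : nat) (p : R) (phi w g : R -> R) (z : R) : R :=
  (1 + w z * w z) * (p * (phi z - z * w z)) - INR n * (w z * (w z * g z)).

Lemma radial_source_continuous n p phi w g z :
  continuous phi z -> continuous w z -> continuous g z -> continuous (radial_source n p phi w g) z.
Proof.
  intros Hphi Hw Hg. unfold radial_source.
  solve_continuous.
Qed.

(** Suppose phi, [w] and [g = w / z] are C^k. The equations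
    for phi and [w] give C^(k+1) for these two. The obstacle is [g], because averaging
    does not gain a derivative: the source contains [w ^ 2 g], seemingly only C^k.
    But [w ^ 2 g = w ^ 3 / z] has derivative [3 w g w' - w g ^ 2], which is C^k, so
    the source is C^(k+1) and so is its average [g]. *)
Lemma bootstrap n p r (phi w g : R -> R) :
  (forall z, Rabs z < r -> is_derive phi z (w z)) ->
  (forall z, Rabs z < r -> is_derive w z (radial_source n p phi w g z - INR n * g z)) ->
  (forall z, Rabs z < r -> w z = z * g z) ->
  (forall z, Rabs z < r -> g z = average n (radial_source n p phi w g) z) ->
  (forall z, Rabs z < r -> continuous g z) ->
  forall k, Ck_on r k phi.
Proof.
  intros Hphi Hw Hwg Hg Hgc.
  set (f := radial_source n p phi w g) in *.
  set (dw := fun z => f z - INR n * g z) in *.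
  assert (Hcube : forall z, Rabs z < r ->
     is_derive (fun z => w z * (w z * g z)) z (3 * (w z * (g z * dw z)) - w z * (g z * g z))).
  { intros z Hz. destruct (Req_dec z 0) as [->|H0].
    - (* at 0 differentiability of [g] is not available, but [w] vanishes there *)
      assert (Hw0 : w 0 = 0) by (rewrite Hwg by exact Hz; ring).
      eapply derive_eq.
      + apply (derive_mult_vanishing w (fun z => w z * g z) (dw 0)).
        * now apply Hw.
        * exact Hw0.
        * apply (continuous_mult (K := R_AbsRing)); [|now apply Hgc].
          eapply derive_continuous. now apply Hw.
      + rewrite Hw0. ring.
    - pose proof (Hw z Hz) as Hwz.
      apply is_derive_ext_loc with (fun z => w z ^ 3 / z).
      + assert (Hd : 0 < Rmin (r - Rabs z) (Rabs z)).
        { apply Rmin_glb_lt; [lra|now apply Rabs_pos_lt]. }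
        exists (mkposreal _ Hd). intros y Hy.
        unfold ball in Hy; simpl in Hy; unfold AbsRing_ball, abs, minus, plus, opp in Hy; simpl in Hy.
        pose proof (Rmin_l (r - Rabs z) (Rabs z)); pose proof (Rmin_r (r - Rabs z) (Rabs z)).
        pose proof (Rabs_shift y z).
        assert (y <> 0).
        { intros ->. rewrite Rplus_0_l, Rabs_Ropp in Hy. lra. }
        assert (E : w y = y * g y) by (apply Hwg; lra).
        replace (w y * (w y * g y)) with (w y ^ 2 * g y) by (simpl; ring).
        rewrite E. simpl. field. assumption.
      + auto_derive.
        * repeat split; [now exists (dw z)|exact H0].
        * rewrite_derive Hwz. fold (dw z). rewrite (Hwg z Hz). field. exact H0. }
  assert (All : forall k, Ck_on r k phi /\ Ck_on r k w /\ Ck_on r k g).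
  { induction k as [|k [IP [IW IG]]].
    - repeat split; intros z Hz; [eapply derive_continuous; now apply Hphi
        |eapply derive_continuous; now apply Hw|now apply Hgc].
    - assert (Hpoly : forall j, Ck_on r j phi -> Ck_on r j w ->
        Ck_on r j (fun z => (1 + w z * w z) * (p * (phi z - z * w z)))).
      { intros j Jp Jw. apply Ck_mult.
        - apply Ck_plus; [apply Ck_const|now apply Ck_mult].
        - apply Ck_mult; [apply Ck_const|]. apply Ck_minus; [exact Jp|].
          apply Ck_mult; [apply Ck_id|exact Jw]. }
      assert (Hdw : Ck_on r k dw).
      { apply Ck_minus; [|apply Ck_mult; [apply Ck_const|exact IG]].
        apply Ck_minus; [now apply Hpoly|].
        apply Ck_mult; [apply Ck_const|]. now repeat apply Ck_mult. }
      assert (SP : Ck_on r (S k) phi) by now exists w.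
      assert (SW : Ck_on r (S k) w) by now exists dw.
      repeat split; [exact SP|exact SW|].
      apply Ck_ext with (average n f); [intros z Hz; symmetry; now apply Hg|].
      apply Ck_average. apply Ck_minus; [now apply Hpoly|].
      apply Ck_mult; [apply Ck_const|].
      exists (fun z => 3 * (w z * (g z * dw z)) - w z * (g z * g z)). split; [exact Hcube|].
      apply Ck_minus; [apply Ck_mult; [apply Ck_const|]|]; now repeat apply Ck_mult. }
  intros k. apply All.
Qed.

(** The slope divided by [z], extended continuously to 0. *)
Definition slope_ratio (n : nat) (p a z : R) : R :=
  angle_ratio n p a z * (1 + trunc_tan_excess (angle n p a z)).

Lemma slope_ratio_spec n p a z : trunc_tan (angle n p a z) = z * slope_ratio n p a z.
Proof.
  unfold slope_ratio. pose proof (trunc_tan_excess_spec (angle n p a z)) as E.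
  unfold angle in *. lra.
Qed.

Lemma slope_ratio_continuous n p a z : 0 < p -> 0 <= a -> continuous (slope_ratio n p a) z.
Proof.
  intros Hp Ha. apply (continuous_mult (K := R_AbsRing)); [now apply angle_ratio_continuous|].
  apply (continuous_plus (V := R_NormedModule)); [apply continuous_const|].
  apply (continuous_comp (angle n p a) trunc_tan_excess); [|apply trunc_tan_excess_continuous].
  eapply derive_continuous, angle_derive; assumption.
Qed.

Lemma angle_ratio_at_0 n p a : 0 < p -> 0 <= a -> angle_ratio n p a 0 = p * a / INR (S n).
Proof.
  intros Hp Ha. rewrite <- angle_ratio_fixed by assumption. unfold picard.
  rewrite average_at_0. unfold forcing, intercept.
  rewrite height_0, !Rmult_0_l, trunc_tan_excess_0. f_equal. ring.
Qed.

Lemma profile_slope_derive n p a z : 0 < p -> 0 <= a ->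
  is_derive (fun z => trunc_tan (angle n p a z)) z
    (trunc_tan_slope (angle n p a z) * (p * (profile n p a z - z * trunc_tan (angle n p a z))
                               - INR n * slope_ratio n p a z)).
Proof.
  intros Hp Ha. eapply derive_eq.
  - apply (is_derive_comp trunc_tan (angle n p a)); [apply trunc_tan_derive|now apply angle_derive].
  - unfold scal; simpl; unfold mult; simpl. rewrite Rmult_comm. f_equal.
    unfold forcing, intercept, slope_ratio. unfold profile, angle. ring.
Qed.

(** As long as the angle stays below [PI/4] the truncated tangent is the
    tangent and the slope [w] satisfies [w' = (1 + w ^ 2) (p (phi - z w) - n w / z)]. *)
Lemma slope_ratio_average n p a r : 0 < p -> 0 <= a ->
  (forall z, Rabs z < r -> Rabs (angle n p a z) < PI / 4) ->
  let f := radial_source n p (profile n p a) (fun z => trunc_tan (angle n p a z)) (slope_ratio n p a) in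
  (forall z, Rabs z < r ->
     is_derive (fun z => trunc_tan (angle n p a z)) z (f z - INR n * slope_ratio n p a z)) /\
  (forall z, Rabs z < r -> slope_ratio n p a z = average n f z).
Proof.
  intros Hp Ha Hr f.
  assert (Hfc : forall z, continuous f z).
  { intros z. apply radial_source_continuous.
    - eapply derive_continuous, profile_derive; assumption.
    - now apply profile_slope_continuous.
    - now apply slope_ratio_continuous. }
  assert (Hd : forall z, Rabs z < r ->
     is_derive (fun z => trunc_tan (angle n p a z)) z (f z - INR n * slope_ratio n p a z)).
  { intros z Hz. eapply derive_eq; [now apply profile_slope_derive|].
    rewrite trunc_tan_slope_tan by now apply Hr. rewrite <- trunc_tan_tan by now apply Hr.
    unfold f, radial_source. ring. }
  split; [exact Hd|]. intros z Hz.
  destruct (Req_dec z 0) as [->|H0].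
  - rewrite average_at_0. unfold slope_ratio, f, radial_source, angle.
    rewrite !Rmult_0_l, trunc_tan_excess_0, trunc_tan_0, angle_ratio_at_0, profile_0 by assumption.
    pose proof (not_0_INR (S n) ltac:(lia)). field. assumption.
  - (* [z ^ n] times the difference of the two moments has derivative 0 *)
    set (dif := fun z => trunc_tan (angle n p a z) - z * average n f z).
    assert (Hdif : forall z, Rabs z < r ->
       is_derive (fun z => z ^ n * dif z) z 0).
    { intros y Hy. eapply derive_eq.
      - apply (is_derive_mult (fun z => z ^ n) dif y (INR n * y ^ pred n)
                 (f y - INR n * slope_ratio n p a y - (f y - INR n * average n f y))).
        + auto_derive; auto. ring.
        + apply (is_derive_minus (V := R_NormedModule)); [now apply Hd|].
          apply average_moment_derive with r; auto.
        + intros; apply Rmult_comm.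
      - unfold plus, mult; simpl. unfold dif. rewrite slope_ratio_spec.
        destruct n as [|m]; [simpl; ring|]. simpl pred. rewrite <- tech_pow_Rmult. ring. }
    pose proof (constant_of_derive_0 _ r Hdif z Hz) as E. cbv beta in E.
    assert (E0 : dif 0 = 0) by (unfold dif, angle; rewrite !Rmult_0_l, trunc_tan_0; ring).
    rewrite E0, Rmult_0_r in E. apply Rmult_integral in E.
    destruct E as [E|E]; [exfalso; revert E; now apply pow_nonzero|].
    unfold dif in E. rewrite slope_ratio_spec in E.
    apply Rmult_eq_reg_l with z; [lra|exact H0].
Qed.

Lemma angle_odd n p a z : 0 < p -> angle n p a (- z) = - angle n p a z.
Proof. intros Hp. unfold angle. rewrite angle_ratio_even by exact Hp. ring. Qed.

(** The bound holds on [0, 1] by monotonicity, slightly beyond 1 by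
    continuity, and on the negative side because the angle is odd. *)
Lemma angle_small n p a : 0 < p -> 0 < a -> angle n p a 1 < PI / 4 ->
  exists r, 1 < r /\ forall z, Rabs z < r -> Rabs (angle n p a z) < PI / 4.
Proof.
  intros Hp Ha H1.
  destruct (continuous_pos_local (fun z => PI / 4 - angle n p a z) 1) as [d [Hd K]].
  { apply (continuous_minus (V := R_NormedModule)); [apply continuous_const|].
    eapply derive_continuous, angle_derive; lra. }
  { lra. }
  destruct (continuous_pos_local (angle n p a) 1) as [d' [Hd' K']].
  { eapply derive_continuous, angle_derive; lra. }
  { apply Rle_lt_trans with (angle n p a 0); [unfold angle; lra|].
    apply angle_increasing; lra. }
  assert (0 < Rmin d d') by (apply Rmin_glb_lt; lra).
  pose proof (Rmin_l d d'); pose proof (Rmin_r d d').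
  assert (P : forall z, 0 <= z < 1 + Rmin d d' -> Rabs (angle n p a z) < PI / 4).
  { intros z Hz. pose proof PI_RGT_0. destruct (Rle_lt_dec z 1) as [Hz1|Hz1].
    - assert (0 <= angle n p a z).
      { destruct (Req_dec z 0) as [->|]; [unfold angle; lra|].
        left. apply Rle_lt_trans with (angle n p a 0); [unfold angle; lra|].
        apply angle_increasing; lra. }
      assert (angle n p a z <= angle n p a 1).
      { destruct (Req_dec z 1) as [->|]; [lra|]. left. apply angle_increasing; lra. }
      rewrite Rabs_right; lra.
    - specialize (K z ltac:(rewrite Rabs_right; lra)).
      specialize (K' z ltac:(rewrite Rabs_right; lra)). rewrite Rabs_right; lra. }
  exists (1 + Rmin d d'). split; [lra|]. intros z Hz.
  destruct (Rle_lt_dec 0 z) as [Hz0|Hz0].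
  - apply P. rewrite Rabs_right in Hz; lra.
  - rewrite <- (Ropp_involutive z), angle_odd, Rabs_Ropp by exact Hp.
    apply P. rewrite Rabs_left in Hz; lra.
Qed.

Lemma profile_smooth n p a : 0 < p -> 0 < a -> angle n p a 1 < PI / 4 ->
  exists r, 1 < r /\ forall j z, Rabs z < r ->
    is_derive (Derive_n (profile n p a) j) z (Derive_n (profile n p a) (S j) z).
Proof.
  intros Hp Ha H1. destruct (angle_small n p a Hp Ha H1) as [r [Hr Hs]].
  destruct (slope_ratio_average n p a r Hp ltac:(lra) Hs) as [Hd Hav].
  exists r. split; [exact Hr|]. apply Ck_Derive_n.
  apply (bootstrap n p r (profile n p a) (fun z => trunc_tan (angle n p a z)) (slope_ratio n p a)).
  - intros z _. apply profile_derive; lra.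
  - exact Hd.
  - intros z _. apply slope_ratio_spec.
  - exact Hav.
  - intros z _. apply slope_ratio_continuous; lra.
Qed.

(** * From one-sided derivatives to two-sided ones *)

Lemma derive_D_in (f d : R -> R) (D : R -> Prop) z : is_derive f z (d z) -> D_in f d D z.
Proof.
  intros H. apply is_derive_Reals in H. intros e He. destruct (H e He) as [alp Ha].
  exists alp. split; [apply cond_pos|]. intros x [[_ Hx] Hd]. simpl in *. unfold Rdist in *.
  specialize (Ha (x - z) ltac:(lra) Hd). replace (z + (x - z)) with x in Ha by ring. exact Ha.
Qed.

Lemma D_in_derive (f d : R -> R) (D : R -> Prop) z r :
  0 < r -> (forall x, z - r < x < z + r -> D x) -> D_in f d D z -> is_derive f z (d z).
Proof.
  intros Hr HD H. apply is_derive_Reals. intros e He. destruct (H e He) as [alp [Ha K]].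
  assert (Hm : 0 < Rmin alp r) by (apply Rmin_glb_lt; lra).
  exists (mkposreal _ Hm). intros h Hh Hd. simpl in *. unfold Rdist in *.
  pose proof (Rmin_l alp r); pose proof (Rmin_r alp r).
  specialize (K (z + h)). replace (z + h - z) with h in K by ring. apply K.
  split; [|lra]. split; [|lra]. apply HD. apply Rabs_def2 in Hd. lra.
Qed.

Lemma continuous_continue_in (f : R -> R) (D : R -> Prop) z :
  continuous f z -> continue_in f D z.
Proof.
  intros H e He. apply continuous_pt in H. destruct (H e He) as [alp [Ha K]].
  exists alp. split; [exact Ha|]. intros x [[_ Hx] Hd]. apply K. split; [|exact Hd].
  split; [exact I|exact Hx].
Qed.

Lemma continue_in_clamp (f : R -> R) :
  (forall z, closed01 z -> continue_in f closed01 z) ->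
  forall z, continuous (fun z => f (clamp 0 1 z)) z.
Proof.
  intros H z. apply continuity_pt_filterlim. intros e He.
  assert (Hz : closed01 (clamp 0 1 z)) by (apply clamp_range; lra).
  destruct (H _ Hz e He) as [alp [Ha K]]. exists alp. split; [exact Ha|].
  intros y [_ Hy]. simpl in *. unfold Rdist in *.
  destruct (Req_dec (clamp 0 1 y) (clamp 0 1 z)) as [->|Hne].
  - rewrite Rminus_diag, Rabs_R0. exact He.
  - apply K. split; [split|].
    + apply clamp_range. lra.
    + auto.
    + eapply Rle_lt_trans; [apply clamp_lipschitz|exact Hy].
Qed.

Lemma clamp_derive (f : R -> R) (l z : R) : 0 < z < 1 ->
  is_derive f z l -> is_derive (fun z => f (clamp 0 1 z)) z l.
Proof.
  intros Hz. apply is_derive_ext_loc.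
  assert (Hm : 0 < Rmin z (1 - z)) by (apply Rmin_glb_lt; lra).
  exists (mkposreal _ Hm). intros y Hy. rewrite clamp_id; [reflexivity|].
  unfold ball in Hy; simpl in Hy; unfold AbsRing_ball, abs, minus, plus, opp in Hy; simpl in Hy.
  pose proof (Rmin_l z (1 - z)); pose proof (Rmin_r z (1 - z)).
  apply Rabs_def2 in Hy. lra.
Qed.

(** Every point of [0, 1] is an accumulation point of it, so one-sided
    derivatives are unique there. *)
Lemma D_in_closed_unique (f g d : R -> R) z (l : R) :
  closed01 z -> (forall x, closed01 x -> f x = g x) ->
  D_in f d closed01 z -> is_derive g z l -> d z = l.
Proof.
  intros Hz E Hd Hg.
  apply (single_limit (fun x => (f x - f z) / (x - z)) (D_x closed01 z) (d z) l z).
  - intros e He. unfold closed01 in *.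
    destruct (Rle_lt_dec z (/ 2)) as [H|H].
    + exists (z + Rmin e 1 / 4). pose proof (Rmin_l e 1); pose proof (Rmin_r e 1).
      assert (0 < Rmin e 1) by (apply Rmin_glb_lt; lra).
      split; [split; lra|]. unfold Rdist. rewrite Rabs_right; lra.
    + exists (z - Rmin e 1 / 4). pose proof (Rmin_l e 1); pose proof (Rmin_r e 1).
      assert (0 < Rmin e 1) by (apply Rmin_glb_lt; lra).
      split; [split; lra|]. unfold Rdist. rewrite Rabs_left; lra.
  - exact Hd.
  - pose proof (derive_D_in g (fun _ => l) closed01 z Hg) as K.
    intros e He. destruct (K e He) as [alp [Ha KK]]. exists alp. split; [exact Ha|].
    intros x Hx. rewrite (E z Hz), (E x) by apply Hx. now apply KK.
Qed.

(** * Uniqueness *)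

(** For [p = 0] the square of the angle is nonincreasing. *)
Lemma comparison_p_nonzero n D V e :
  0 <= n -> comparison n 0 (fun _ => 0) D V e -> e 1 <= 0.
Proof.
  intros Hn H. apply Rnot_lt_le. intros Hpos.
  assert (K : - (e 0 * e 0) <= - (e 1 * e 1)).
  { apply (derive_nonneg_le (fun z => - (e z * e z)) (fun z => 2 * (n / z * (V z * e z)))); [lra| |].
    - intros z Hz. pose proof (cmp_e_derive _ _ _ _ _ _ H z Hz) as Hd. split.
      + auto_derive; [repeat split; exact (ex_intro _ _ Hd)|]. rewrite_derive Hd. ring.
      + apply Rmult_le_pos; [lra|]. apply Rmult_le_pos; [apply Rdiv_le_0_compat; lra|].
        destruct (Rtotal_order (e z) 0) as [He|[He|He]].
        * pose proof (cmp_neg _ _ _ _ _ _ H z He). nra.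
        * rewrite He. lra.
        * pose proof (cmp_pos _ _ _ _ _ _ H z He). nra.
    - intros z _. apply (continuous_opp (V := R_NormedModule)).
      pose proof (cmp_e_cont _ _ _ _ _ _ H z) as He. solve_continuous. }
  rewrite (cmp_e0 _ _ _ _ _ _ H) in K. nra.
Qed.

(** A solution [phi] replaced by a function [f] continuous on the whole line,
    with angle [t], together with the sign information needed for uniqueness. The slope
    is written [trunc_tan (t z)], so that any two solutions share the same nonlinearity. *)
Record extension (n k p : R) (phi f t : R -> R) : Prop := {
  ext_agree : forall z, closed01 z -> f z = phi z;
  ext_comparison : comparison n p (fun _ => 0) f (fun z => trunc_tan (t z)) t;
  ext_f1 : f 1 = 1;
  ext_t1 : t 1 = atan k;
  ext_curvature : forall z, 0 < z <= 1 ->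
    0 < p * (f z - z * trunc_tan (t z)) - n / z * trunc_tan (t z);
  ext_slope : forall z, 0 <= z <= 1 -> 0 <= trunc_tan (t z) }.

(** Continue phi and phi' by their end values. The comparison
    lemmas apply with the true tangent and give [phi 0 > 0] from [phi' 1 = k > 0], then
    positive curvature, so that phi' increases from 0 to [k < 1]; there the tangent
    and its truncation coincide. *)
Lemma solution_extension n k p phi :
  0 < k < 1 -> 0 <= p -> is_solution (S n) k p phi ->
  0 < p /\ exists f t, extension (INR n) k p phi f t.
Proof.
  intros Hk Hp0 [w [dw [HD [Hwc [HDw [_ [Heq [Hw0 [H1 Hw1]]]]]]]]].
  set (f := fun z => phi (clamp 0 1 z)). set (W := fun z => w (clamp 0 1 z)).
  set (t := fun z => atan (W z)).
  assert (EN : INR (S n) - 1 = INR n) by (rewrite S_INR; ring).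
  assert (Hfc : forall z, continuous f z).
  { apply continue_in_clamp. intros z Hz. now apply cont_deriv with w, HD. }
  assert (HWc : forall z, continuous W z) by now apply continue_in_clamp.
  assert (Hatanc : forall x, continuous atan x).
  { intros x. eapply derive_continuous, is_derive_atan. }
  assert (Htc : forall z, continuous t z).
  { intros z. apply (continuous_comp W atan); [apply HWc|apply Hatanc]. }
  assert (Hid : forall z, 0 < z < 1 -> f z = phi z /\ W z = w z).
  { intros z Hz. unfold f, W. rewrite clamp_id by lra. auto. }
  assert (Hfd : forall z, 0 < z < 1 -> is_derive f z (W z)).
  { intros z Hz. rewrite (proj2 (Hid z Hz)). apply clamp_derive; [exact Hz|].
    assert (0 < Rmin z (1 - z)) by (apply Rmin_glb_lt; lra).
    pose proof (Rmin_l z (1 - z)); pose proof (Rmin_r z (1 - z)).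
    apply D_in_derive with closed01 (Rmin z (1 - z)); [assumption| |].
    - intros x Hx. unfold closed01. lra.
    - apply HD. unfold closed01. lra. }
  set (G := fun z => p * (f z - z * W z) - INR n / z * W z).
  assert (HWd : forall z, 0 < z < 1 -> is_derive W z ((1 + W z ^ 2) * G z)).
  { intros z Hz. destruct (Hid z Hz) as [E1 E2].
    replace ((1 + W z ^ 2) * G z) with (dw z).
    - apply clamp_derive; [exact Hz|].
      assert (0 < Rmin z (1 - z)) by (apply Rmin_glb_lt; lra).
      pose proof (Rmin_l z (1 - z)); pose proof (Rmin_r z (1 - z)).
      apply D_in_derive with open01 (Rmin z (1 - z)); [assumption| |].
      + intros x Hx. unfold open01. lra.
      + apply HDw. exact Hz.
    - unfold G. rewrite E1, E2, <- EN, <- Heq by exact Hz. field.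
      pose proof (pow2_ge_0 (w z)). lra. }
  assert (Htd : forall z, 0 < z < 1 -> is_derive t z (G z + 0)).
  { intros z Hz. eapply derive_eq.
    - apply (is_derive_comp atan W); [apply is_derive_atan|now apply HWd].
    - unfold scal; simpl; unfold mult; simpl. unfold Rsqr. field. nra. }
  assert (Hpos : forall x, 0 < atan x -> 0 < x).
  { intros x Hx. apply Rnot_le_lt. intros [Hn| ->]; [|rewrite atan_0 in Hx; lra].
    apply atan_increasing in Hn. rewrite atan_0 in Hn. lra. }
  assert (Hneg : forall x, atan x < 0 -> x < 0).
  { intros x Hx. apply Rnot_le_lt. intros [Hn|<-]; [|rewrite atan_0 in Hx; lra].
    apply atan_increasing in Hn. rewrite atan_0 in Hn. lra. }
  assert (HW0 : W 0 = 0) by (unfold W; rewrite clamp_id by lra; exact Hw0).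
  assert (HW1 : W 1 = k) by (unfold W; rewrite clamp_id by lra; exact Hw1).
  assert (Hf1 : f 1 = 1) by (unfold f; rewrite clamp_id by lra; exact H1).
  assert (Hcmp : comparison (INR n) p (fun _ => 0) f W t).
  { constructor; auto.
    - unfold t. rewrite HW0. apply atan_0.
    - intros z Hz. apply Rle_antisym; apply Rnot_lt_le; intros Hc.
      + apply atan_increasing in Hc. rewrite atan_0 in Hc. unfold t in Hz. lra.
      + apply atan_increasing in Hc. rewrite atan_0 in Hc. unfold t in Hz. lra.  }
  assert (Ht1 : t 1 = atan k) by (unfold t; now rewrite HW1).
  assert (Hk0 : 0 < atan k) by (rewrite <- atan_0; apply atan_increasing; lra).
  assert (Hp : 0 < p).
  { destruct Hp0 as [|<-]; [assumption|].
    pose proof (comparison_p_nonzero _ _ _ _ (pos_INR n) Hcmp). lra. }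
  split; [exact Hp|].
  destruct (attains_max (fun z => Rabs (W z)) 0 1) as [m [_ Hm]]; [lra| |].
  { intros z. apply (continuous_comp W Rabs); [apply HWc|apply continuous_Rabs]. }
  set (B := Rabs (W m)) in *.
  assert (HB : forall z, 0 <= z <= 1 -> W z ^ 2 <= B ^ 2).
  { intros z Hz. rewrite <- (pow2_abs (W z)). specialize (Hm z Hz).
    pose proof (Rabs_pos (W z)). nra. }
  assert (Hf0 : 0 < f 0).
  { destruct (continuous_pos_local t 1 (Htc 1) ltac:(lra)) as [d [Hd K]].
    assert (0 < Rmin d 1) by (apply Rmin_glb_lt; lra).
    pose proof (Rmin_l d 1); pose proof (Rmin_r d 1).
    apply (comparison_start_positive (INR n) p f W t (1 + B ^ 2) (1 - Rmin d 1 / 2)); auto.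
    - apply pos_INR.
    - nra.
    - (* [w <= (1 + B ^ 2) * atan w] for [0 <= w <= B], by the mean value theorem *)
      intros z Hz Htz. pose proof (comparison_V_nonneg _ _ _ _ _ _ z Hcmp Htz) as [HWz|<-].
      + destruct (mean_value atan (fun x => / (1 + x²)) 0 (W z) HWz) as [c [Hc E]].
        { intros x _. apply is_derive_atan. }
        { intros x _. apply Hatanc. }
        rewrite atan_0, !Rminus_0_r in E. unfold t. rewrite E. unfold Rsqr.
        specialize (HB z Hz).
        assert (Hcc : 1 + c * c <= 1 + B ^ 2) by nra.
        assert (0 < 1 + c * c) by nra.
        apply Rmult_le_reg_r with (1 + c * c); [assumption|].
        replace ((1 + B ^ 2) * (/ (1 + c * c) * W z) * (1 + c * c)) with ((1 + B ^ 2) * W z)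
          by (field; lra).
        nra.
      + apply Rmult_le_pos; [nra|exact Htz].
    - lra.
    - apply K. rewrite Rabs_left; lra. }
  assert (HG : forall z, 0 < z <= 1 -> 0 < G z).
  { apply (curvature_positive (INR n) p (1 + B ^ 2) f W t (fun z => 1 + W z ^ 2)); auto.
    - apply pos_INR.
    - intros z Hz. pose proof (pow2_ge_0 (W z)). specialize (HB z ltac:(lra)). lra. }
  assert (HWk : forall z, 0 <= z <= 1 -> 0 <= W z <= k).
  { intros z Hz. split.
    - rewrite <- HW0. apply (derive_nonneg_le W (fun z => (1 + W z ^ 2) * G z)); [lra| |auto].
      intros x Hx. split; [apply HWd; lra|]. specialize (HG x ltac:(lra)).
      pose proof (pow2_ge_0 (W x)). nra.
    - rewrite <- HW1. apply (derive_nonneg_le W (fun z => (1 + W z ^ 2) * G z)); [lra| |auto].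
      intros x Hx. split; [apply HWd; lra|]. specialize (HG x ltac:(lra)).
      pose proof (pow2_ge_0 (W x)). nra. }
  assert (Htan : forall z, trunc_tan (t z) = W z).
  { intros z. apply trunc_tan_atan.
    assert (Hc : 0 <= clamp 0 1 z <= 1) by (apply clamp_range; lra).
    pose proof (HWk _ Hc) as K. unfold W in K. rewrite clamp_id in K by exact Hc.
    fold (W z) in K. rewrite Rabs_right; lra. }
  exists f, t. constructor; auto.
  - intros z Hz. unfold f. now rewrite clamp_id.
  - constructor; try apply Hcmp.
    + intros z Hz. rewrite Htan. now apply Hfd.
    + intros z Hz. rewrite Htan. now apply Htd.
    + intros z Hz. rewrite Htan. now apply (cmp_pos _ _ _ _ _ _ Hcmp).
    + intros z Hz. rewrite Htan. now apply (cmp_zero _ _ _ _ _ _ Hcmp).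
    + intros z Hz. rewrite Htan. now apply (cmp_neg _ _ _ _ _ _ Hcmp).
  - intros z Hz. rewrite Htan. now apply HG.
  - intros z Hz. rewrite Htan. now apply HWk.
Qed.

Lemma extension_same_p n k p phi1 phi2 f1 f2 t1 t2 :
  0 <= n -> 0 < p -> extension n k p phi1 f1 t1 -> extension n k p phi2 f2 t2 ->
  forall z, closed01 z -> phi1 z = phi2 z.
Proof.
  intros Hn Hp E1 E2 z Hz.
  assert (Half : forall f g t s phi psi, extension n k p phi f t -> extension n k p psi g s ->
    forall x, 0 < x < 1 -> s x - t x <= 0).
  { intros f g t s phi psi F1 F2 x Hx.
    apply (comparison_nonpos n p (fun z => g z - f z) (fun z => trunc_tan (s z) - trunc_tan (t z))
             (fun z => s z - t z) 2); auto; [lra| | |].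
    - apply (difference_comparison n (fun _ => 0) f g t s p p).
      + apply F1.
      + apply F2.
      + intros. ring.
    - intros y _ Hy. pose proof (trunc_tan_increment (t y) (s y)). lra.
    - rewrite (ext_f1 _ _ _ _ _ _ F1), (ext_f1 _ _ _ _ _ _ F2). lra. }
  rewrite <- (ext_agree _ _ _ _ _ _ E1 z Hz), <- (ext_agree _ _ _ _ _ _ E2 z Hz).
  destruct (Req_dec z 1) as [->|Hz1].
  { now rewrite (ext_f1 _ _ _ _ _ _ E1), (ext_f1 _ _ _ _ _ _ E2). }
  unfold closed01 in Hz.
  destruct (mean_value (fun z => f2 z - f1 z) (fun z => trunc_tan (t2 z) - trunc_tan (t1 z)) z 1)
    as [c [Hc E]]; [lra| | |].
  - intros x Hx. apply (is_derive_minus (V := R_NormedModule)).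
    + apply (cmp_D_derive _ _ _ _ _ _ (ext_comparison _ _ _ _ _ _ E2)). lra.
    + apply (cmp_D_derive _ _ _ _ _ _ (ext_comparison _ _ _ _ _ _ E1)). lra.
  - intros x _. apply (continuous_minus (V := R_NormedModule)).
    + apply (cmp_D_cont _ _ _ _ _ _ (ext_comparison _ _ _ _ _ _ E2)).
    + apply (cmp_D_cont _ _ _ _ _ _ (ext_comparison _ _ _ _ _ _ E1)).
  - pose proof (Half _ _ _ _ _ _ E1 E2 c ltac:(lra)). pose proof (Half _ _ _ _ _ _ E2 E1 c ltac:(lra)).
    replace (t2 c) with (t1 c) in E by lra.
    rewrite (ext_f1 _ _ _ _ _ _ E1), (ext_f1 _ _ _ _ _ _ E2) in E. lra.
Qed.

(** Suppose [p1 < p2]. Near 1 the angles satisfy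
    [theta2' - theta1' > 0], since this difference tends to [(p2 - p1) (1 - k)] at 1
    where the data agree. Going left from 1 the second slope is the smaller one, so
    [f2 > f1] just before 1, which [comparison_source_contradiction] excludes. *)
Lemma extension_p_le n k p1 p2 phi1 phi2 f1 f2 t1 t2 :
  0 <= n -> 0 < k < 1 -> 0 < p1 -> 0 < p2 ->
  extension n k p1 phi1 f1 t1 -> extension n k p2 phi2 f2 t2 -> p2 <= p1.
Proof.
  intros Hn Hk Hp1 Hp2 E1 E2. apply Rnot_lt_le. intros Hlt.
  pose proof (ext_comparison _ _ _ _ _ _ E1) as C1.
  pose proof (ext_comparison _ _ _ _ _ _ E2) as C2.
  set (r := fun z => (p2 - p1) * (f2 z - z * trunc_tan (t2 z))).
  pose proof (difference_comparison n r f1 f2 t1 t2 p1 p2 C1 C2 ltac:(reflexivity)) as C.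
  assert (Hr : forall z, 0 < z < 1 -> 0 <= r z).
  { intros z Hz. unfold r. apply Rmult_le_pos; [lra|].
    pose proof (ext_curvature _ _ _ _ _ _ E2 z ltac:(lra)) as Hc.
    pose proof (ext_slope _ _ _ _ _ _ E2 z ltac:(lra)) as Hs.
    assert (0 <= n / z * trunc_tan (t2 z)) by (apply Rmult_le_pos; [apply Rdiv_le_0_compat; lra|lra]).
    apply Rnot_lt_le. intros Hneg. nra. }
  apply (comparison_source_contradiction n p1 r _ _ _ Hp1 Hn Hr C).
  { rewrite (ext_f1 _ _ _ _ _ _ E1), (ext_f1 _ _ _ _ _ _ E2). lra. }
  set (h := fun z => p1 * ((f2 z - f1 z) - z * (trunc_tan (t2 z) - trunc_tan (t1 z)))
                     - n / z * (trunc_tan (t2 z) - trunc_tan (t1 z)) + r z).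
  assert (Hslope : forall t : R -> R, (forall z, continuous t z) ->
            forall z, continuous (fun z => trunc_tan (t z)) z).
  { intros t Ht z. apply (continuous_comp (t : R -> R) trunc_tan); [apply Ht|apply trunc_tan_continuous]. }
  pose proof (Hslope t1 (cmp_e_cont _ _ _ _ _ _ C1)) as S1.
  pose proof (Hslope t2 (cmp_e_cont _ _ _ _ _ _ C2)) as S2.
  pose proof (cmp_D_cont _ _ _ _ _ _ C1) as F1. pose proof (cmp_D_cont _ _ _ _ _ _ C2) as F2.
  assert (Hh : continuous h 1).
  { assert (Hinv : continuous (fun z => n / z) 1).
    { apply (ex_derive_continuous (V := R_NormedModule)). auto_derive. lra. }
    unfold h, r.
    specialize (S1 1). specialize (S2 1). specialize (F1 1). specialize (F2 1).
    solve_continuous. }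
  assert (Hh1 : 0 < h 1).
  { unfold h, r. rewrite (ext_f1 _ _ _ _ _ _ E1), (ext_f1 _ _ _ _ _ _ E2),
      (ext_t1 _ _ _ _ _ _ E1), (ext_t1 _ _ _ _ _ _ E2), trunc_tan_atan by (rewrite Rabs_right; lra).
    nra. }
  destruct (continuous_pos_local h 1 Hh Hh1) as [d [Hd K]].
  set (x := 1 - Rmin d 1 / 2).
  assert (0 < Rmin d 1) by (apply Rmin_glb_lt; lra).
  pose proof (Rmin_l d 1); pose proof (Rmin_r d 1).
  assert (Hx : 0 < x < 1 /\ 1 - d < x) by (unfold x; lra).
  assert (Hneg : forall y, x <= y < 1 -> t2 y - t1 y < 0).
  { intros y Hy.
    replace 0 with (t2 1 - t1 1) by (rewrite (ext_t1 _ _ _ _ _ _ E1), (ext_t1 _ _ _ _ _ _ E2); ring).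
    apply (derive_pos_lt (fun z => t2 z - t1 z) h); [lra| |intros; apply C].
    intros z Hz. split; [apply (cmp_e_derive _ _ _ _ _ _ C); lra|].
    apply K, Rabs_def1; lra. }
  exists x. split; [lra|].
  assert (- (f2 x - f1 x) < - (f2 1 - f1 1)).
  { apply (derive_pos_lt (fun z => - (f2 z - f1 z)) (fun z => - (trunc_tan (t2 z) - trunc_tan (t1 z)))); [lra| |].
    - intros z Hz. split.
      + apply (is_derive_opp (V := R_NormedModule)), (cmp_D_derive _ _ _ _ _ _ C). lra.
      + pose proof (cmp_neg _ _ _ _ _ _ C z (Hneg z ltac:(lra))) as Q. cbv beta in Q. lra.
    - intros z _. apply (continuous_opp (V := R_NormedModule)), C. }
  rewrite (ext_f1 _ _ _ _ _ _ E1), (ext_f1 _ _ _ _ _ _ E2) in *. lra.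
Qed.

(** * Conclusion *)

Lemma profile_is_solution n k p a : 0 < k < 1 -> 0 < p -> 0 < a ->
  profile n p a 1 = 1 -> angle n p a 1 = atan k ->
  is_solution (S n) k p (profile n p a).
Proof.
  intros Hk Hp Ha H1 Ht1.
  set (w := fun z => trunc_tan (angle n p a z)).
  set (dw := fun z => trunc_tan_slope (angle n p a z) * (p * (profile n p a z - z * w z) - INR n * slope_ratio n p a z)).
  assert (Hsmall : forall z, 0 < z < 1 -> Rabs (angle n p a z) < PI / 4).
  { intros z Hz. rewrite Rabs_right by (left; apply angle_positive; auto).
    eapply Rlt_trans; [apply (angle_increasing n p a z 1); lra|].
    rewrite Ht1. pose proof (atan_small k ltac:(rewrite Rabs_right; lra)) as K.
    apply Rabs_def2 in K. lra. }
  exists w, dw. split; [|split; [|split; [|split; [|split; [|split; [|split]]]]]].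
  - intros z _. apply derive_D_in. apply profile_derive; lra.
  - intros z _. apply continuous_continue_in. apply profile_slope_continuous; lra.
  - intros z _. apply derive_D_in. apply profile_slope_derive; lra.
  - intros z _. apply continuous_continue_in. apply (continuous_mult (K := R_AbsRing)).
    { apply (continuous_comp (angle n p a) trunc_tan_slope); [|apply trunc_tan_slope_continuous].
      eapply derive_continuous, angle_derive; lra. }
    apply (continuous_minus (V := R_NormedModule)).
    + apply (continuous_mult (K := R_AbsRing)); [apply continuous_const|].
      apply (continuous_minus (V := R_NormedModule)).
      * eapply derive_continuous, profile_derive; lra.
      * apply (continuous_mult (K := R_AbsRing)); [apply continuous_id|].
        apply profile_slope_continuous; lra.
    + apply (continuous_mult (K := R_AbsRing)); [apply continuous_const|].
      apply slope_ratio_continuous; lra.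
  - intros z Hz. unfold open01 in Hz. unfold dw.
    rewrite trunc_tan_slope_tan, <- trunc_tan_tan by now apply Hsmall. fold (w z).
    assert (Ew : w z = z * slope_ratio n p a z) by apply slope_ratio_spec.
    rewrite S_INR. replace (INR n + 1 - 1) with (INR n) by ring.
    replace (INR n / z * w z) with (INR n * slope_ratio n p a z) by (rewrite Ew; field; lra).
    field. pose proof (pow2_ge_0 (w z)). lra.
  - unfold w, angle. rewrite Rmult_0_l. apply trunc_tan_0.
  - exact H1.
  - unfold w. rewrite Ht1. apply trunc_tan_atan. rewrite Rabs_right; lra.
Qed.

(** For [z > 0] this is the curvature. At 0 the value is
    [p a - n p a / (n + 1) = p a / (n + 1)]. *)
Lemma profile_second_positive n p a z : 0 < p -> 0 < a -> 0 <= z <= 1 ->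
  0 < trunc_tan_slope (angle n p a z) * (p * (profile n p a z - z * trunc_tan (angle n p a z))
                               - INR n * slope_ratio n p a z).
Proof.
  intros Hp Ha Hz. apply Rmult_lt_0_compat.
  - pose proof (trunc_tan_slope_range (angle n p a z)). lra.
  - destruct (Req_dec z 0) as [->|H0].
    + assert (E0 : angle n p a 0 = 0) by (unfold angle; ring).
      unfold slope_ratio. rewrite E0, trunc_tan_0, trunc_tan_excess_0, profile_0, angle_ratio_at_0 by lra.
      pose proof (pos_INR n). rewrite S_INR.
      replace (p * (a - 0 * 0) - INR n * (p * a / (INR n + 1) * (1 + 0)))
        with (p * a / (INR n + 1)) by (field; lra).
      apply Rdiv_lt_0_compat; nra.
    + replace (INR n * slope_ratio n p a z) with (INR n / z * trunc_tan (angle n p a z)).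
      * apply profile_curvature; lra.
      * rewrite slope_ratio_spec. field. exact H0.
Qed.

Theorem proposition2p6 (N : nat) (k : R) (hN : (1 <= N)%nat) (hk : 0 < k < 1) :
  exists P : R,
    unique (fun p : R =>
      P2 N k <= p <= P1 N k /\ exists phi, is_solution N k p phi) P /\
    exists Phi : R -> R,
      is_solution N k P Phi /\
      (forall phi, is_solution N k P phi ->
         forall z, closed01 z -> phi z = Phi z) /\
      smooth closed01 Phi /\
      (forall z, open01 z -> 0 < Phi z < 1) /\
      (forall d, iterated_derivatives closed01 Phi d ->
         (forall z, open01 z -> 0 < d 1%nat z < k) /\
         (forall z, closed01 z -> 0 < d 2%nat z)).
Proof.
  destruct N as [|n]; [lia|]. clear hN.
  assert (EN : INR (S n) - 1 = INR n) by (rewrite S_INR; ring).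
  pose proof (pos_INR n) as Hn.
  assert (Hk0 : 0 < atan k) by (rewrite <- atan_0; apply atan_increasing; lra).
  assert (EP1 : P1 (S n) k * (1 - k) = 2 * atan k + (k + 4) * INR n).
  { unfold P1. rewrite EN. field. lra. }
  assert (HP2 : 0 <= P2 (S n) k) by (unfold P2; rewrite EN; nra).
  destruct (shooting n k (P1 (S n) k) hk) as [P [a [HP [Ha [H1 Ht1]]]]].
  { apply Rmult_le_reg_r with (1 - k); [lra|]. rewrite EP1. nra. }
  { rewrite EP1. nra. }
  assert (Hp : 0 < P) by lra.
  assert (Hsol : is_solution (S n) k P (profile n P a)) by (apply profile_is_solution; lra).
  exists P. split.
  { split.
    - split; [|now exists (profile n P a)]. split; [|lra].
      pose proof (profile_curvature n P a 1 Hp ltac:(lra) ltac:(lra)) as K.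
      rewrite H1, Ht1, trunc_tan_atan in K by (rewrite Rabs_right; lra).
      unfold P2. rewrite EN. nra.
    - intros p' [Hp' [phi Hphi]].
      destruct (solution_extension n k P _ hk ltac:(lra) Hsol) as [_ [f1 [t1 E1]]].
      destruct (solution_extension n k p' _ hk ltac:(lra) Hphi) as [Hp'0 [f2 [t2 E2]]].
      apply Rle_antisym.
      + now apply (extension_p_le (INR n) k p' P phi (profile n P a) f2 f1 t2 t1).
      + now apply (extension_p_le (INR n) k P p' (profile n P a) phi f1 f2 t1 t2). }
  exists (profile n P a). split; [exact Hsol|]. split; [|split; [|split]].
  - intros phi Hphi z Hz.
    destruct (solution_extension n k P _ hk ltac:(lra) Hsol) as [_ [f1 [t1 E1]]].
    destruct (solution_extension n k P _ hk ltac:(lra) Hphi) as [_ [f2 [t2 E2]]].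
    now apply (extension_same_p (INR n) k P phi (profile n P a) f2 f1 t2 t1).
  - destruct (profile_smooth n P a Hp ltac:(lra)) as [r [Hr Hd]].
    { rewrite Ht1. pose proof (atan_small k ltac:(rewrite Rabs_right; lra)) as K.
      apply Rabs_def2 in K. lra. }
    exists (Derive_n (profile n P a)). split; [reflexivity|].
    intros j z Hz. apply derive_D_in. apply Hd. unfold closed01 in Hz.
    rewrite Rabs_right; lra.
  - intros z Hz. unfold open01 in Hz.
    pose proof (profile_increasing n P a 0 z Hp ltac:(lra) ltac:(lra) ltac:(lra)) as K.
    rewrite profile_0 in K. split; [lra|]. rewrite <- H1.
    apply (derive_pos_lt (profile n P a) (fun z => trunc_tan (angle n P a z))); [lra| |].
    + intros x Hx. split; [apply profile_derive; lra|].
      rewrite <- trunc_tan_0. apply trunc_tan_increasing, angle_positive; lra.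
    + intros x _. eapply derive_continuous, profile_derive; lra.
  - intros d [Hd0 HdS].
    assert (E1 : forall z, closed01 z -> d 1%nat z = trunc_tan (angle n P a z)).
    { intros z Hz. apply (D_in_closed_unique (d 0%nat) (profile n P a) (d 1%nat) z); auto.
      apply profile_derive; lra. }
    split.
    + intros z Hz. unfold open01 in Hz. rewrite E1 by (unfold closed01; lra). split.
      * rewrite <- trunc_tan_0 at 1. apply trunc_tan_increasing, angle_positive; lra.
      * rewrite <- (trunc_tan_atan k), <- Ht1 by (rewrite Rabs_right; lra).
        apply trunc_tan_increasing, angle_increasing; lra.
    + intros z Hz.
      rewrite (D_in_closed_unique (d 1%nat) (fun z => trunc_tan (angle n P a z)) (d 2%nat) z
        (trunc_tan_slope (angle n P a z) * (P * (profile n P a z - z * trunc_tan (angle n P a z))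
                               - INR n * slope_ratio n P a z))); auto.
      * apply profile_second_positive; [lra|lra|exact Hz].
      * apply profile_slope_derive; lra.
Qed.
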